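(* Let $Q$ be a finite quandle. Then there exists an integer-valued polynomial $P_Q(x)\in\mathbb{Q}[x]$ such that $$\int_{\widehat{B_n}} c_{Q}\,d\mu = P_Q(n)$$ for all sufficiently large $n\in\mathbb{N}$. Here $c_Q=c_{Q,n}\colon\widehat{B_n}\to\mathbb{N}$ is the continuous extension to the profinite completion of the braid group $B_n$ of the function $\sigma\mapsto|\mathrm{Col}_Q(\overline{\sigma})|$ counting $Q$-colorings of the closure $\overline\sigma$ of a braid $\sigma$, and $\mu$ is the normalized Haar measure on $\widehat{B_n}$.
   Context: A quandle is a set $Q$ with a binary operation $(x,y)\mapsto {}^{x}y$ such that (Q1) ${}^{x}x=x$ for all $x$; (Q2) for every $x$ the map $\varphi_x\colon Q\to Q$, $\varphi_x(y)={}^{x}y$, is a bijection; (Q3) ${}^{x}({}^{y}z)={}^{({}^{x}y)}({}^{x}z)$ for all $x,y,z$. A morphism of quandles is a map $f$ with $f({}^{x}y)={}^{f(x)}f(y)$. A finite quandle is one with finite underlying set. Oriented (tame) links in $S^3$ are described by diagrams $D$ with a finite set $arcs(D)$ of oriented arcs. For an arc $x$ ending at a crossing as under-strand, $n_x$ is the next arc (the continuation of the under-strand), $c_x$ is the arc passing over $x$ and $n_x$ at that crossing, and $\varepsilon_x\in\{\pm1\}$ is the orientation of the crossing: rotating the picture so that both strands point downwards, $\varepsilon_x=1$ if the over-strand goes from upper left to lower right, and $\varepsilon_x=-1$ if it goes from upper right to lower left. The fundamental quandle $Q_L$ of the link $L$ is the quandle generated by $arcs(D)$ subject to the relations $\varphi_{c_x}^{\varepsilon_x}(x)=n_x$;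 up to isomorphism it does not depend on the diagram $D$ of $L$. The set of $Q$-colorings of $L$ is $\mathrm{Col}_Q(L)=\mathrm{Hom}(Q_L,Q)$ (quandle morphisms); equivalently, maps $f\colon arcs(D)\to Q$ with $\varphi_{f(c_x)}^{\varepsilon_x}(f(x))=f(n_x)$ at every crossing. It is finite when $Q$ is finite. $B_n$ is the Artin braid group on $n$ strands, with generators $\sigma_1,\dots,\sigma_{n-1}$ and relations $\sigma_i\sigma_{i+1}\sigma_i=\sigma_{i+1}\sigma_i\sigma_{i+1}$ and $[\sigma_i,\sigma_j]=1$ for $|i-j|\ge2$. Braids are oriented downwards; in $\sigma_i$ the strand starting on top at position $i$ passes over the strand starting at position $i+1$. The closure $\overline\sigma$ is the oriented link obtained by joining the bottom endpoints of $\sigma$ to the corresponding top endpoints without introducing crossings. $\widehat{B_n}$ is the profinite completion of $B_n$, with Haar measure $\mu$ of total mass $1$. The function $B_n\to\mathbb{N}$, $\sigma\mapsto|\mathrm{Col}_Q(\overline\sigma)|$, factors through a finite quotient of $B_n$, so it extends uniquely to a continuous (locally constant) function $c_{Q,n}$ on $\widehat{B_n}$. A polynomial $P\in\mathbb{Q}[x]$ is integer-valued if $P(\mathbb{Z})\subseteq\mathbb{Z}$. *)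

(* Defs.v *)
From HB Require Import structures.
From mathcomp Require Import all_boot all_order all_algebra perm finmap.
From mathcomp Require Import all_classical all_reals all_analysis.
Import GRing.Theory Num.Theory.

Set Implicit Arguments.
Unset Strict Implicit.
Unset Printing Implicit Defensive.

Local Open Scope quotient_scope.
Local Open Scope classical_set_scope.

(* [qop x y] is written ^x y on paper; the map phi_x is [qop x]. *)
HB.mixin Record isQuandle Q := {
  qop : Q -> Q -> Q;
  qopxx : forall x, qop x x = x;
  qop_bij : forall x, bijective (qop x);
  qopD : forall x y z, qop x (qop y z) = qop (qop x y) (qop x z)
}.

#[short(type="quandleType")]
HB.structure Definition Quandle := {Q of isQuandle Q}.

#[short(type="finQuandleType")]
HB.structure Definition FinQuandle := {Q of Finite Q & isQuandle Q}.

Definition quandle_morphism (Q Q' : quandleType) (f : Q -> Q') : Prop :=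
  forall x y, f (qop x y) = qop (f x) (f y).

(* The part of an oriented link diagram which the fundamental quandle sees.  At
   a crossing, the arc [under_in] ends as under-strand and continues as
   [under_out], and the arc [over_arc] passes over both; [is_positive] tells
   whether the orientation of the crossing is +1 or -1. *)
Record diagram := Diagram {
  diagram_arc : finType;
  crossing : finType;
  under_in : crossing -> diagram_arc;
  under_out : crossing -> diagram_arc;
  over_arc : crossing -> diagram_arc;
  is_positive : crossing -> bool
}.

(* [QInv t u] stands for phi_t^-1 (u). *)
Inductive qterm (A : Type) : Type :=
  | QGen of A
  | QAct of qterm A & qterm A
  | QInv of qterm A & qterm A.

HB.instance Definition _ (A : Type) := gen_eqMixin (qterm A).
HB.instance Definition _ (A : Type) := gen_choiceMixin (qterm A).

Inductive qterm_eq (D : diagram) :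
    qterm (diagram_arc D) -> qterm (diagram_arc D) -> Prop :=
  | qterm_refl t : qterm_eq t t
  | qterm_sym t u : qterm_eq t u -> qterm_eq u t
  | qterm_trans t u v : qterm_eq t u -> qterm_eq u v -> qterm_eq t v
  | qterm_act t t' u u' :
      qterm_eq t t' -> qterm_eq u u' -> qterm_eq (QAct t u) (QAct t' u')
  | qterm_inv t t' u u' :
      qterm_eq t t' -> qterm_eq u u' -> qterm_eq (QInv t u) (QInv t' u')
  | qterm_idem t : qterm_eq (QAct t t) t
  | qterm_actK t u : qterm_eq (QInv t (QAct t u)) u
  | qterm_invK t u : qterm_eq (QAct t (QInv t u)) u
  | qterm_distr t u v :
      qterm_eq (QAct t (QAct u v)) (QAct (QAct t u) (QAct t v))
  | qterm_crossing (k : crossing D) :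
      qterm_eq ((if is_positive k then @QAct _ else @QInv _)
                  (QGen (over_arc k)) (QGen (under_in k)))
               (QGen (under_out k)).

Section FundamentalQuandle.
Variable D : diagram.

Definition qterm_eqb : rel (qterm (diagram_arc D)) :=
  fun t u => `[< qterm_eq t u >].

Lemma qterm_eqb_refl : reflexive qterm_eqb.
Proof. by move=> t; apply/asboolP; exact: qterm_refl. Qed.

Lemma qterm_eqb_sym : symmetric qterm_eqb.
Proof. by move=> t u; apply/asboolP/asboolP; exact: qterm_sym. Qed.

Lemma qterm_eqb_trans : transitive qterm_eqb.
Proof.
by move=> u t v /asboolP tu /asboolP uv; apply/asboolP; exact: qterm_trans uv.
Qed.

Canonical qterm_equiv :=
  EquivRel qterm_eqb qterm_eqb_refl qterm_eqb_sym qterm_eqb_trans.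

Definition fund_quandle : Type := {eq_quot qterm_eqb}.
HB.instance Definition _ := Choice.on fund_quandle.
HB.instance Definition _ := EqQuotient.on fund_quandle.

Lemma fund_quandle_eqP t u :
  \pi_fund_quandle t = \pi_fund_quandle u <-> qterm_eq t u.
Proof.
split=> [/eqP|tu]; first by rewrite piE => /asboolP.
by apply/eqP; rewrite piE; apply/asboolP.
Qed.

Lemma repr_fund_quandle t : qterm_eq (repr (\pi_fund_quandle t)) t.
Proof. by apply/fund_quandle_eqP; rewrite reprK. Qed.

Definition fund_act (x y : fund_quandle) : fund_quandle :=
  \pi_fund_quandle (QAct (repr x) (repr y)).

Definition fund_inv (x y : fund_quandle) : fund_quandle :=
  \pi_fund_quandle (QInv (repr x) (repr y)).

Lemma fund_actE t u :
  fund_act (\pi t) (\pi u) = \pi_fund_quandle (QAct t u).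
Proof. by apply/fund_quandle_eqP/qterm_act; exact: repr_fund_quandle. Qed.

Lemma fund_invE t u :
  fund_inv (\pi t) (\pi u) = \pi_fund_quandle (QInv t u).
Proof. by apply/fund_quandle_eqP/qterm_inv; exact: repr_fund_quandle. Qed.

Fact fund_actxx x : fund_act x x = x.
Proof.
rewrite -[x]reprK fund_actE; apply/fund_quandle_eqP; exact: qterm_idem.
Qed.

Fact fund_act_bij x : bijective (fund_act x).
Proof.
exists (fund_inv x) => y; rewrite -[x]reprK -[y]reprK.
  by rewrite fund_actE fund_invE; apply/fund_quandle_eqP; exact: qterm_actK.
by rewrite fund_invE fund_actE; apply/fund_quandle_eqP; exact: qterm_invK.
Qed.

Fact fund_actD x y z :
  fund_act x (fund_act y z) = fund_act (fund_act x y) (fund_act x z).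
Proof.
rewrite -[x]reprK -[y]reprK -[z]reprK !fund_actE.
by apply/fund_quandle_eqP; exact: qterm_distr.
Qed.

HB.instance Definition _ :=
  isQuandle.Build fund_quandle fund_actxx fund_act_bij fund_actD.

Definition coloring (Q : finQuandleType) : set (fund_quandle -> Q) :=
  [set f | quandle_morphism f].
Arguments coloring : clear implicits.

(* [fset_set] returns the empty set on infinite sets; [finite_coloring] below
   shows that this case does not occur. *)
Definition num_coloring (Q : finQuandleType) : nat :=
  #|` fset_set (coloring Q)|%fset.

Lemma coloring_ext (Q : finQuandleType) (f g : fund_quandle -> Q) :
  coloring Q f -> coloring Q g ->
  (forall a, f (\pi_fund_quandle (QGen a)) = g (\pi_fund_quandle (QGen a))) ->
  f = g.
Proof.
move=> fM gM fg; apply/funext => x; rewrite -[x]reprK.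
elim: (repr x) => [a //|t IHt u IHu|t IHt u IHu].
  have -> : \pi_fund_quandle (QAct t u) = qop (\pi_fund_quandle t) (\pi_fund_quandle u).
    by rewrite -fund_actE.
  by rewrite fM gM IHt IHu.
apply: (bij_inj (qop_bij (f (\pi_fund_quandle t)))); rewrite -fM [in RHS]IHt -gM.
have -> : qop (\pi_fund_quandle t) (\pi_fund_quandle (QInv t u)) = \pi_fund_quandle u.
  rewrite [LHS]fund_actE; apply/fund_quandle_eqP; exact: qterm_invK.
exact: IHu.
Qed.

Lemma finite_coloring (Q : finQuandleType) : finite_set (coloring Q).
Proof.
pose h (f : fund_quandle -> Q) := [ffun a => f (\pi_fund_quandle (QGen a))].
suff inj : {in coloring Q &, injective h}.
  by rewrite -(eq_finite_set (inj_card_eq inj)); exact: finite_finset.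
move=> f g; rewrite !inE => fM gM /ffunP fg; apply: coloring_ext => // a.
by have := fg a; rewrite !ffunE.
Qed.

End FundamentalQuandle.
Arguments coloring : clear implicits.
Arguments num_coloring : clear implicits.

(* The letter [(i, true)] is sigma_(i+1) and [(i, false)] its inverse: positions
   and generators are numbered from 0. *)
Definition braid_letter (n : nat) : Type := ('I_n.-1 * bool)%type.
HB.instance Definition _ n := Countable.on (braid_letter n).

Definition braid_word (n : nat) : Type := seq (braid_letter n).
HB.instance Definition _ n := Countable.on (braid_word n).

Inductive braid_eq (n : nat) : braid_word n -> braid_word n -> Prop :=
  | braid_refl u : braid_eq u u
  | braid_sym u v : braid_eq u v -> braid_eq v u
  | braid_trans u v w : braid_eq u v -> braid_eq v w -> braid_eq u w
  | braid_cat u u' v v' :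
      braid_eq u u' -> braid_eq v v' -> braid_eq (u ++ v) (u' ++ v')
  | braid_cancel (i : 'I_n.-1) (b : bool) :
      braid_eq [:: (i, b); (i, ~~ b)] [::]
  | braid_artin (i j : 'I_n.-1) : j = i.+1 :> nat ->
      braid_eq [:: (i, true); (j, true); (i, true)]
               [:: (j, true); (i, true); (j, true)]
  | braid_far (i j : 'I_n.-1) : (i.+2 <= j)%N ->
      braid_eq [:: (i, true); (j, true)] [:: (j, true); (i, true)].

Section BraidGroup.
Variable n : nat.
Implicit Types u v w : braid_word n.

Definition braid_eqb : rel (braid_word n) := fun u v => `[< braid_eq u v >].

Lemma braid_eqb_refl : reflexive braid_eqb.
Proof. by move=> t; apply/asboolP; exact: braid_refl. Qed.

Lemma braid_eqb_sym : symmetric braid_eqb.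
Proof. by move=> t u; apply/asboolP/asboolP; exact: braid_sym. Qed.

Lemma braid_eqb_trans : transitive braid_eqb.
Proof.
by move=> u t v /asboolP tu /asboolP uv; apply/asboolP; exact: braid_trans uv.
Qed.

Canonical braid_equiv :=
  EquivRel braid_eqb braid_eqb_refl braid_eqb_sym braid_eqb_trans.

Definition braid : Type := {eq_quot braid_eqb}.
HB.instance Definition _ := Choice.on braid.
HB.instance Definition _ := EqQuotient.on braid.

Lemma braid_eqP u v : \pi_braid u = \pi_braid v <-> braid_eq u v.
Proof.
split=> [/eqP|tu]; first by rewrite piE => /asboolP.
by apply/eqP; rewrite piE; apply/asboolP.
Qed.

Lemma repr_braid u : braid_eq (repr (\pi_braid u)) u.
Proof. by apply/braid_eqP; rewrite reprK. Qed.

Definition word_inv u : braid_word n := rev [seq (l.1, ~~ l.2) | l <- u].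

Lemma word_invK : involutive word_inv.
Proof.
move=> u; rewrite /word_inv map_rev revK -map_comp -[RHS]map_id.
by apply: eq_map => -[i b] /=; rewrite negbK.
Qed.

Lemma cat_word_inv u : braid_eq (u ++ word_inv u) [::].
Proof.
elim: u => [|[i b] u IHu]; first exact: braid_refl.
rewrite /word_inv map_cons rev_cons -cats1 -/(word_inv u) /= -cat_cons catA.
apply: braid_trans (braid_cancel i b).
rewrite -[X in braid_eq X]/([:: (i, b)] ++ ((u ++ word_inv u) ++ [:: (i, ~~ b)])).
apply: braid_cat (braid_refl [:: (i, b)]) _.
exact: braid_cat IHu (braid_refl [:: (i, ~~ b)]).
Qed.

Lemma word_inv_cat u : braid_eq (word_inv u ++ u) [::].
Proof. by rewrite -{2}[u]word_invK; exact: cat_word_inv. Qed.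

Lemma braid_inv u v : braid_eq u v -> braid_eq (word_inv u) (word_inv v).
Proof.
move=> uv; apply: (@braid_trans _ _ (word_inv u ++ (v ++ word_inv v))).
  rewrite -{1}[word_inv u]cats0; apply: braid_cat (braid_refl _) _.
  exact/braid_sym/cat_word_inv.
rewrite catA -[X in braid_eq _ X]cat0s; apply: braid_cat (braid_refl _).
apply: braid_trans (word_inv_cat u); apply: braid_cat (braid_refl _) _.
exact: braid_sym.
Qed.

Definition braid_mul (x y : braid) : braid := \pi_braid (repr x ++ repr y).
Definition braid_one : braid := \pi_braid [::].
Definition braid_invg (x : braid) : braid := \pi_braid (word_inv (repr x)).

Lemma braid_mulE u v : braid_mul (\pi u) (\pi v) = \pi_braid (u ++ v).
Proof. by apply/braid_eqP/braid_cat; exact: repr_braid. Qed.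

Lemma braid_invgE u : braid_invg (\pi u) = \pi_braid (word_inv u).
Proof. by apply/braid_eqP/braid_inv; exact: repr_braid. Qed.

Fact braid_mulA : associative braid_mul.
Proof.
by move=> x y z; rewrite -[x]reprK -[y]reprK -[z]reprK !braid_mulE catA.
Qed.

Fact braid_mul1 : left_id braid_one braid_mul.
Proof. by move=> x; rewrite -[x]reprK braid_mulE. Qed.

Fact braid_mulr1 : right_id braid_one braid_mul.
Proof. by move=> x; rewrite -[x]reprK braid_mulE cats0. Qed.

Fact braid_mulV : left_inverse braid_one braid_invg braid_mul.
Proof.
move=> x; rewrite -[x]reprK braid_invgE braid_mulE.
by apply/braid_eqP; exact: word_inv_cat.
Qed.

Fact braid_mulrV : right_inverse braid_one braid_invg braid_mul.
Proof.
move=> x; rewrite -[x]reprK braid_invgE braid_mulE.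
by apply/braid_eqP; exact: cat_word_inv.
Qed.

HB.instance Definition _ := isGroup.Build braid
  braid_mulA braid_mul1 braid_mulr1 braid_mulV braid_mulrV.

End BraidGroup.

Section Closure.
Variables (n : nat) (w : braid_word n).

(* The letters of [w] are stacked from top to bottom, the [k]-th one lying
   between the horizontal levels [k] and [k.+1].  The point [(k, a)] is where
   the strand in position [a] (from the left) meets level [k]. *)
Definition closure_point : finType := ('I_(size w).+1 * 'I_n)%type.

Implicit Type k : 'I_(size w).

Definition lev_above k : 'I_(size w).+1 := widen_ord (leqnSn _) k.
Definition lev_below k : 'I_(size w).+1 := lift ord0 k.

Definition letter k : braid_letter n := tnth (in_tuple w) k.
Definition pos_left k : 'I_n := widen_ord (leq_pred n) (letter k).1.

Fact pos_right_subproof k : ((letter k).1.+1 < n)%N.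
Proof. by rewrite -ltn_predRL; exact: ltn_ord. Qed.

Definition pos_right k : 'I_n := Ordinal (pos_right_subproof k).

(* In sigma_i the over-strand goes from upper left to lower right, so that the
   crossing is positive; in its inverse it goes from upper right to lower left.
   The under-strand leaves where the over-strand enters. *)
Definition over_pos k := if (letter k).2 then pos_left k else pos_right k.
Definition under_pos k := if (letter k).2 then pos_right k else pos_left k.

Definition strand_end k (a : 'I_n) : 'I_n := tperm (pos_left k) (pos_right k) a.

(* [closure_step p q]: the oriented link runs from [p] to the next point [q],
   through a letter or along a closing strand, without passing under. *)
Definition closure_step (p q : closure_point) : bool :=
  [exists k, exists a, [&& a != under_pos k,
      p == (lev_above k, a) & q == (lev_below k, strand_end k a)]]
  || [exists a, (p == (ord_max, a)) && (q == (ord0, a))].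

Definition same_arc : rel closure_point :=
  connect (fun p q => closure_step p q || closure_step q p).

Definition arc_set (p : closure_point) : {set closure_point} :=
  [set q | same_arc p q]%SET.

Definition closure_arc : finType :=
  {A : {set closure_point} | [exists p, A == arc_set p]}.

Fact arc_set_subproof p : [exists q, arc_set p == arc_set q].
Proof. by apply/existsP; exists p. Qed.

Definition arc_of (p : closure_point) : closure_arc :=
  exist _ (arc_set p) (arc_set_subproof p).

Definition closure_diagram : diagram := {|
  diagram_arc := closure_arc;
  crossing := 'I_(size w);
  under_in k := arc_of (lev_above k, under_pos k);
  under_out k := arc_of (lev_below k, strand_end k (under_pos k));
  over_arc k := arc_of (lev_above k, over_pos k);
  is_positive k := (letter k).2
|}.

End Closure.

(* The number of Q-colorings of the closure of a braid; the link does not depend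
   on the word representing the braid. *)
Definition closure_colorings (Q : finQuandleType) (n : nat)
    (s : braid n) : nat :=
  num_coloring (closure_diagram (repr s)) Q.

Local Open Scope group_scope.

Section Profinite.
Variable G : groupType.

Definition gcoset (N : set G) (x : G) : set G := [set x * y | y in N].

Record finite_index_normal := FiniteIndexNormal {
  fin_carrier :> set G;
  fin_1 : fin_carrier 1;
  fin_M : forall x y, fin_carrier x -> fin_carrier y -> fin_carrier (x * y);
  fin_V : forall x, fin_carrier x -> fin_carrier x^-1;
  fin_J : forall x y, fin_carrier x -> fin_carrier (y^-1 * x * y);
  fin_index : finite_set (range (gcoset fin_carrier))
}.

HB.instance Definition _ := gen_eqMixin finite_index_normal.
HB.instance Definition _ := gen_choiceMixin finite_index_normal.

(* The inverse limit of the finite quotients G/N: an element is a family of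
   cosets, compatible with the projections G/N -> G/M for N contained in M. *)
Record profinite_completion := Profinite {
  coset_at : finite_index_normal -> set G;
  coset_atP : forall N : finite_index_normal, range (gcoset N) (coset_at N);
  coset_at_compat : forall N M : finite_index_normal,
    (N `<=` M)%classic -> (coset_at N `<=` coset_at M)%classic
}.

HB.instance Definition _ := gen_eqMixin profinite_completion.
HB.instance Definition _ := gen_choiceMixin profinite_completion.

(* The topology induced by the product of the discrete spaces G/N. *)
HB.instance Definition _ := Topological.copy profinite_completion
  (initial_topology (coset_at : profinite_completion ->
     prod_topology (fun _ : finite_index_normal => discrete_topology (set G)))).

Lemma profinite_eq (x y : profinite_completion) :
  (forall N, coset_at x N = coset_at y N) -> x = y.
Proof.
case: x y => [x xc xk] [y yc yk] /= /funext xy.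
by case: _ / xy in yc yk *; congr Profinite; exact: Prop_irrelevance.
Qed.

Lemma gcoset_id (N : finite_index_normal) x : gcoset N x x.
Proof. by exists 1; [exact: fin_1|rewrite mulg1]. Qed.

Lemma gcosetP (N : finite_index_normal) x y :
  gcoset N x y <-> fin_carrier N (x^-1 * y).
Proof.
split=> [[z Nz <-]|Nxy]; first by rewrite mulKg.
by exists (x^-1 * y) => //; rewrite mulVKg.
Qed.

Definition gcoset_mul (A B : set G) : set G := [set x * y | x in A & y in B].

Lemma gcoset_mulE (N : finite_index_normal) x y :
  gcoset_mul (gcoset N x) (gcoset N y) = gcoset N (x * y).
Proof.
apply/seteqP; split=> [z [_ [a Na <-] [_ [b Nb <-] <-]]|z [a Na <-]].
  exists (y^-1 * a * y * b); first exact: fin_M (fin_J _ Na) Nb.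
  by rewrite !mulgA mulgK.
by exists x; [exact: gcoset_id|exists (y * a); [exists a|rewrite mulgA]].
Qed.

Definition gcoset_inv (A : set G) : set G := [set x^-1 | x in A].

Lemma gcoset_invE (N : finite_index_normal) x :
  gcoset_inv (gcoset N x) = gcoset N x^-1.
Proof.
apply/seteqP; split=> [_ [_ [a Na <-] <-]|_ [a Na <-]].
  exists (x * a^-1 * x^-1); last by rewrite invgM !mulgA mulVg mul1g.
  by have := fin_J x^-1 (fin_V Na); rewrite invgK.
exists (x * (x^-1 * a^-1 * x)); last by rewrite !invgM !invgK !mulgA mulgK.
by exists (x^-1 * a^-1 * x) => //; exact/fin_J/fin_V.
Qed.

Definition of_group (g : G) : profinite_completion.
Proof.
exists (fun N => gcoset N g) => [N|N M NM _ [y Ny <-]]; first by exists g.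
by exists y => //; exact: NM.
Defined.

Definition profinite_mul (x y : profinite_completion) : profinite_completion.
Proof.
exists (fun N => gcoset_mul (coset_at x N) (coset_at y N)) => [N|N M NM _ [a xa [b yb <-]]].
  have [a _ <-] := coset_atP x N; have [b _ <-] := coset_atP y N.
  by rewrite gcoset_mulE; exists (a * b).
by exists a; [exact: (coset_at_compat NM)|exists b => //; exact: (coset_at_compat NM)].
Defined.

Definition profinite_inv (x : profinite_completion) : profinite_completion.
Proof.
exists (fun N => gcoset_inv (coset_at x N)) => [N|N M NM _ [a xa <-]].
  by have [a _ <-] := coset_atP x N; rewrite gcoset_invE; exists a^-1.
by exists a => //; exact: (coset_at_compat NM).
Defined.

Fact profinite_mulA : associative profinite_mul.
Proof.
move=> x y z; apply: profinite_eq => N /=.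
have [a _ <-] := coset_atP x N; have [b _ <-] := coset_atP y N.
by have [c _ <-] := coset_atP z N; rewrite !gcoset_mulE mulgA.
Qed.

Fact profinite_mul1 : left_id (of_group 1) profinite_mul.
Proof.
move=> x; apply: profinite_eq => N /=.
by have [a _ <-] := coset_atP x N; rewrite gcoset_mulE mul1g.
Qed.

Fact profinite_mulr1 : right_id (of_group 1) profinite_mul.
Proof.
move=> x; apply: profinite_eq => N /=.
by have [a _ <-] := coset_atP x N; rewrite gcoset_mulE mulg1.
Qed.

Fact profinite_mulV : left_inverse (of_group 1) profinite_inv profinite_mul.
Proof.
move=> x; apply: profinite_eq => N /=.
by have [a _ <-] := coset_atP x N; rewrite gcoset_invE gcoset_mulE mulVg.
Qed.

Fact profinite_mulrV : right_inverse (of_group 1) profinite_inv profinite_mul.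
Proof.
move=> x; apply: profinite_eq => N /=.
by have [a _ <-] := coset_atP x N; rewrite gcoset_invE gcoset_mulE mulgV.
Qed.

HB.instance Definition _ := isGroup.Build profinite_completion
  profinite_mulA profinite_mul1 profinite_mulr1 profinite_mulV profinite_mulrV.

HB.instance Definition _ :=
  isPointed.Build profinite_completion (1 : profinite_completion).

Definition borel_profinite : measurableType _ :=
  g_sigma_algebraType (@open profinite_completion).

End Profinite.

(* Left translation invariance.  Regularity need not be required for a finitely
   generated [G] such as a braid group: the completion is then a compact
   metrizable space, on which every finite Borel measure is regular. *)
Definition normalized_haar (G : groupType) (R : realType)
    (mu : probability (borel_profinite G) R) : Prop :=
  forall (g : profinite_completion G) (A : set (borel_profinite G)),
    measurable A -> mu [set (g * x : profinite_completion G) | x in A] = mu A.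

Definition continuous_extension (G : groupType) (f : G -> nat)
    (c : profinite_completion G -> nat) : Prop :=
  continuous c /\ forall g : G, c (of_group g) = f g.

Definition integer_valued (P : {poly rat}) : Prop :=
  forall z : int, (P.[z%:~R])%R \is a Num.int.

(* Main.v *)
(* By continuity [c] factors through the finite image of [B_n] in the permutations
   of [Q^n], where a coloring of the closure of a braid is a fixed point of that
   braid.  The Haar measure induces the uniform measure on this image, so by
   Burnside's lemma the integral is the number of orbits of [B_n] on [Q^n], that
   is, of words of length [n] modulo [x y ~ (^x y) x].

   The letters of a word [w] generate a partition of [Q] (the finest one with [a]
   and [^y a] in the same part for all letters [y]), which only depends on the
   class of [w], as does the number of letters of [w] in each part.  If some part
   [O] contains sufficiently many letters, then one of them is repeated more than
   [k] times, where all [phi_x^k = id], and [w ~ x^k w'] with [x] in [w'].  As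
   [x^k] is central, it may be conjugated by the letters of [w'], so
   [w ~ i^k w'] for every [i] in [O].  Hence prefixing [i] is onto the classes
   with one more letter in [O]: the number of classes with a given partition is
   a function of the multidegree which is eventually nonincreasing in each
   coordinate.  The sum of such a function over the multidegrees of total degree
   [n] is eventually a polynomial in [n]. *)
Require Import Defs.
From HB Require Import structures.
From mathcomp Require Import all_boot all_order all_algebra ring.
From mathcomp Require Import all_fingroup cyclic perm finmap.
From mathcomp Require Import all_classical all_reals all_analysis.
From mathcomp Require Import measurable_realfun.
Import Order.TTheory GRing.Theory Num.Theory.

Set Implicit Arguments.
Unset Strict Implicit.
Unset Printing Implicit Defensive.

(** * Eventually polynomial sequences *)

Section EventuallyPolynomial.
Local Open Scope ring_scope.

(** The [k]-th iterated difference of [f] is eventually zero, that is, [f] is eventually a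
    polynomial of degree less than [k]. In this form closure under sums, shifts and partial sums is
    a short induction on [k]; the polynomial is extracted in [ev_polyP]. *)
Fixpoint diff_vanishes (k : nat) (f : nat -> int) : Prop :=
  if k is k'.+1 then diff_vanishes k' (fun n => f n.+1 - f n)
  else exists N : nat, forall n, (N <= n)%N -> f n = 0.

Definition ev_poly (f : nat -> int) : Prop := exists k, diff_vanishes k f.

Lemma diff_vanishes_ext k f g (M : nat) :
  (forall n, (M <= n)%N -> f n = g n) -> diff_vanishes k f -> diff_vanishes k g.
Proof.
elim: k f g => [|k IHk] f g fg /=.
  move=> [N fN]; exists (maxn M N) => n; rewrite geq_max => /andP[Mn Nn].
  by rewrite -fg // fN.
by apply: IHk => n Mn; rewrite !fg // leqW.
Qed.

Lemma diff_vanishesS k f : diff_vanishes k f -> diff_vanishes k.+1 f.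
Proof.
elim: k f => [|k IHk] f.
  by case=> N fN; exists N => n Nn; rewrite !fN ?subrr // leqW.
exact: IHk.
Qed.

Lemma diff_vanishes_leq k l f : (k <= l)%N -> diff_vanishes k f -> diff_vanishes l f.
Proof.
move=> /subnK <-; elim: (l - k)%N => [//|m IHm] fk.
by rewrite addSn; apply: diff_vanishesS; exact: IHm.
Qed.

Lemma diff_vanishesD k f g :
  diff_vanishes k f -> diff_vanishes k g -> diff_vanishes k (fun n => f n + g n).
Proof.
elim: k f g => [|k IHk] f g /=.
  move=> [N fN] [M gM]; exists (maxn N M) => n; rewrite geq_max => /andP[Nn Mn].
  by rewrite fN // gM // addr0.
move=> df dg; apply: (diff_vanishes_ext (M := 0)) (IHk _ _ df dg) => n _ /=.
by rewrite opprD addrACA.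
Qed.

Lemma ev_poly_ext f g (M : nat) :
  (forall n, (M <= n)%N -> f n = g n) -> ev_poly f -> ev_poly g.
Proof. by move=> fg [k fk]; exists k; exact: diff_vanishes_ext fg fk. Qed.

Lemma ev_poly0 : ev_poly (fun=> 0).
Proof. by exists 0; exists 0. Qed.

Lemma ev_polyD f g : ev_poly f -> ev_poly g -> ev_poly (fun n => f n + g n).
Proof.
move=> [k fk] [l gl]; exists (maxn k l); apply: diff_vanishesD.
  exact: diff_vanishes_leq (leq_maxl _ _) fk.
exact: diff_vanishes_leq (leq_maxr _ _) gl.
Qed.

Lemma ev_poly_sum (I : Type) (r : seq I) (F : I -> nat -> int) :
  (forall i, ev_poly (F i)) -> ev_poly (fun n => \sum_(i <- r) F i n).
Proof.
move=> ev_F; elim: r => [|i r IHr].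
  by apply: (ev_poly_ext (M := 0)) ev_poly0 => n _; rewrite big_nil.
by apply: (ev_poly_ext (M := 0)) (ev_polyD (ev_F i) IHr) => n _; rewrite big_cons.
Qed.

Lemma ev_poly_shift c f : ev_poly f -> ev_poly (fun n => f (n - c)%N).
Proof.
move=> [k fk]; exists k; elim: k f fk => [|k IHk] f /=.
  case=> N fN; exists (N + c)%N => n Nn; rewrite fN //.
  by rewrite leq_subRL ?(leq_trans (leq_addl _ _) Nn) // addnC.
move=> /IHk; apply: (diff_vanishes_ext (M := c)) => n cn /=.
by rewrite subSn.
Qed.

(** The difference of the partial sums is the shifted sequence [f n.+1], so one more difference
    suffices. *)
Lemma ev_poly_psum f : ev_poly f -> ev_poly (fun n => \sum_(0 <= m < n.+1) f m).
Proof.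
move=> [k fk]; exists k.+1 => /=.
have : diff_vanishes k (fun n => f n.+1).
  elim: k f fk => [|k IHk] f /=.
    by case=> N fN; exists N => n Nn; rewrite fN // leqW.
  by move=> /IHk.
apply: (diff_vanishes_ext (M := 0)) => n _.
by rewrite [in RHS]big_nat_recr //= addrAC subrr add0r.
Qed.

(** The difference of [a *: 'X^(m.+1)] has top coefficient [a * m.+1%:R], in degree [m]. Choosing
    [a] to cancel the top coefficient of [P] lowers the size bound. *)
Lemma poly_antidiff (P : {poly rat}) :
  exists R : {poly rat}, forall x, R.[x + 1] - R.[x] = P.[x].
Proof.
elim: {P}(size P) {-2}P (leqnn (size P)) => [|m IHm] P.
  rewrite leqn0 size_poly_eq0 => /eqP ->; exists 0 => x.
  by rewrite !horner0 subr0.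
move=> szP; pose a := P`_m / m.+1%:R.
pose S : {poly rat} := a *: ((('X + 1%:P) ^+ m.+1) - 'X^(m.+1)).
have SE : S = P`_m *: 'X^m + a *: \sum_(i < m) 'X^i *+ 'C(m.+1, i).
  rewrite /S addrC (_ : ('X + 1%:P) ^+ m.+1 =
      'X^(m.+1) + ('X^m *+ m.+1 + \sum_(i < m) 'X^i *+ 'C(m.+1, i))).
    rewrite addKr scalerDr; congr (_ + _).
    by rewrite -scaler_nat scalerA divfK // pnatr_eq0.
  rewrite polyC1 [_ + 1]addrC exprDn 2!big_ord_recr /= subnn expr0 mul1r binn.
  rewrite subSnn expr1n mul1r mulr1n binSn [RHS]addrC; congr (_ + _).
  by rewrite addrC; congr (_ + _); apply: eq_bigr => i _; rewrite expr1n mul1r.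
have szPS : (size (P - S)%R <= m)%N.
  apply/leq_sizeP => j mj.
  rewrite coefB SE coefD !coefZ coefXn coef_sum big1 => [|i _]; last first.
    by rewrite coefMn coefXn gtn_eqF ?mul0rn // (leq_trans (ltn_ord i)).
  move: mj; rewrite leq_eqVlt => /predU1P[<-|mj].
    by rewrite eqxx mulr0 addr0 mulr1 subrr.
  by rewrite (gtn_eqF mj) mulr0n !mulr0 add0r subr0 nth_default // (leq_trans szP).
have [R HR] := IHm _ szPS.
exists (R + a *: 'X^(m.+1)) => x.
have -> : P.[x] = (P - S).[x] + S.[x] by rewrite -hornerD subrK.
rewrite -HR /S !hornerE /=.
by ring.
Qed.

(** Integrality at the single point [n] spreads upwards and downwards by unit steps. *)
Lemma int_of_steps (f : rat -> rat) (n : nat) :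
  (forall z : int, f (z%:~R + 1) - f z%:~R \is a Num.int) ->
  f n%:R \is a Num.int -> forall z : int, f z%:~R \is a Num.int.
Proof.
move=> df fn.
have {}df (z : int) : f (z + 1)%:~R - f z%:~R \is a Num.int by rewrite intrD.
have up (z : int) (m : nat) : f z%:~R \is a Num.int -> f (z + m%:Z)%:~R \is a Num.int.
  move=> fz; elim: m => [|m IHm]; first by rewrite addr0.
  rewrite -[f _](subrK (f (z + m%:Z)%:~R)) rpredD // -addn1 PoszD addrA.
  exact: df.
have down (z : int) (m : nat) : f z%:~R \is a Num.int -> f (z - m%:Z)%:~R \is a Num.int.
  move=> fz; elim: m => [|m IHm]; first by rewrite subr0.
  have := df (z - m.+1%:Z); rewrite -addrA.
  have -> : - m.+1%:Z + 1 = - m%:Z by rewrite -addn1 PoszD opprD addrNK.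
  by move=> /(rpredB IHm); rewrite opprB addrCA subrr addr0.
move=> z; rewrite -[z](subrK n%:Z) addrC.
by case: (z - n%:Z) => m; [exact: up|rewrite NegzE; exact: down].
Qed.

(** A polynomial for the difference is summed, and its free constant is fixed by the value at the
    threshold [N]. Integrality follows from [int_of_steps]: the steps are values of [P], and the
    value at [N] is [f N]. *)
Lemma ev_polyP f : ev_poly f ->
  exists2 P : {poly rat}, integer_valued P &
    exists N : nat, forall n, (N <= n)%N -> (f n)%:~R = P.[n%:R].
Proof.
case=> k; elim: k f => [|k IHk] f /=.
  case=> N fN; exists 0 => [z|]; first by rewrite horner0 rpred0.
  by exists N => n Nn; rewrite horner0 fN.
move=> /IHk[P P_int [N fP]]; have [R dR] := poly_antidiff P.
pose S := R + ((f N)%:~R - R.[N%:R])%:P.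
have dS x : S.[x + 1] - S.[x] = P.[x].
  by rewrite -dR !hornerD !hornerC opprD addrACA subrr addr0.
have SN : S.[N%:R] = (f N)%:~R by rewrite hornerD hornerC addrC subrK.
exists S.
  apply: (int_of_steps (n := N)) => [z|]; last by rewrite SN intr_int.
  by rewrite dS; exact: P_int.
exists N => n /subnKC <-; elim: (n - N)%N => [|m IHm]; first by rewrite addn0 SN.
have := fP (N + m)%N (leq_addr _ _); rewrite -dS rmorphB /= -IHm => /addIr.
by rewrite addnS -natr1.
Qed.

End EventuallyPolynomial.

(** * Sums over compositions *)

Section Compositions.
Local Open Scope nat_scope.

(** Only the growing coordinate has to be past [M]; the other ones are arbitrary. *)
Definition ev_nonincreasing (M q : nat) (g : seq nat -> nat) : Prop :=
  forall d j, size d = q -> j < q -> M <= nth 0 d j -> g (incr_nth d j) <= g d.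

Lemma ev_nonincreasing_cons M q g c :
  ev_nonincreasing M q.+1 g -> ev_nonincreasing M q (g \o cons c).
Proof. by move=> gM d j dq jq Md; apply: (gM (c :: d) j.+1) => //=; rewrite dq. Qed.

(** Induction on a bound for [u M]: either the sequence meets a smaller bound later and the argument
    restarts there, or it is constant from [M] on. *)
Lemma nonincreasing_stable (u : nat -> nat) (M : nat) :
  (forall c, M <= c -> u c.+1 <= u c) ->
  exists C, forall c, C <= c -> u c = u C.
Proof.
move=> u_dec.
have decr a b : M <= a -> a <= b -> u b <= u a.
  move=> Ma /subnKC <-; elim: (b - a) => [|m IHm]; first by rewrite addn0.
  rewrite addnS; apply: leq_trans IHm; apply: u_dec.
  by rewrite (leq_trans Ma) ?leq_addr.
elim: {M u_dec}(u M) {-2}M (leqnn (u M)) decr => [|m IHm] M uM decr.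
  exists M => c Mc; have := decr M c (leqnn M) Mc.
  by move: uM; rewrite leqn0 => /eqP ->; rewrite leqn0 => /eqP.
have [[c Mc uc]|stable] := pselect (exists2 c, M <= c & u c <= m).
  by apply: (IHm c) => // a b ca; apply: decr; exact: leq_trans ca.
exists M => c Mc; apply/eqP; rewrite eqn_leq decr //=.
apply: leq_trans uM _; rewrite ltnNge; apply/negP => uc.
by apply: stable; exists c.
Qed.

(* On the diagonal [d = c] the functions [g c (d :: _)] form a nonincreasing
   sequence again, and its stabilization at [C] forces that of [g c (d :: _)] on
   [c, d >= C]; finitely many slices [d < C] remain. *)
Lemma ev_nonincreasing_stable (M q : nat) (g : nat -> seq nat -> nat) :
  (forall c, ev_nonincreasing M q (g c)) ->
  (forall c d, M <= c -> size d = q -> g c.+1 d <= g c d) ->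
  exists C, forall c d, C <= c -> size d = q -> g c d = g C d.
Proof.
elim: q g => [|q IHq] g g_incr g_dec.
  have [C gC] := @nonincreasing_stable (fun c => g c [::]) M
    (fun c Mc => g_dec c [::] Mc erefl).
  by exists C => c d Cc /size0nil ->; exact: gC.
have decc a b d : M <= a -> a <= b -> size d = q.+1 -> g b d <= g a d.
  move=> Ma /subnKC <- dq; elim: (b - a) => [|m IHm]; first by rewrite addn0.
  rewrite addnS; apply: leq_trans IHm; apply: g_dec => //.
  by rewrite (leq_trans Ma) ?leq_addr.
have decd c a b d : M <= a -> a <= b -> size d = q -> g c (b :: d) <= g c (a :: d).
  move=> Ma /subnKC <- dq; elim: (b - a) => [|m IHm]; first by rewrite addn0.
  rewrite addnS; apply: leq_trans IHm.
  apply: (g_incr c (a + m :: d) 0) => //=; first by rewrite dq.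
  by rewrite (leq_trans Ma) ?leq_addr.
have [C0 gC0] : exists C, forall c d, C <= c -> size d = q ->
    g c (c :: d) = g C (C :: d).
  apply: (IHq (fun c d => g c (c :: d))) => [c|c d Mc dq].
    exact: ev_nonincreasing_cons.
  by apply: leq_trans (decd _ _ _ _ Mc (leqnSn c) dq); apply: g_dec; rewrite //= dq.
pose C1 := maxn M C0.
have MC1 : M <= C1 by exact: leq_maxl.
(* The value is squeezed between the diagonal ones at [C1] and at [maxn c e], which coincide. *)
have diag c e d : C1 <= c -> C1 <= e -> size d = q -> g c (e :: d) = g C1 (C1 :: d).
  move=> Cc Ce dq; pose m := maxn c e; apply/eqP; rewrite eqn_leq; apply/andP; split.
    apply: leq_trans (decd C1 C1 e d MC1 Ce dq).
    by apply: decc => //=; rewrite dq.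
  have -> : g C1 (C1 :: d) = g m (m :: d).
    have C01 : C0 <= C1 by exact: leq_maxr.
    have C0m : C0 <= m by rewrite (leq_trans C01) // (leq_trans Cc) // leq_maxl.
    by rewrite (gC0 m) // (gC0 C1).
  apply: leq_trans (decd m e m d (leq_trans MC1 Ce) (leq_maxr _ _) dq) _.
  by apply: decc; rewrite /= ?dq ?(leq_trans MC1 Cc) ?leq_maxl.
have slices e : exists C, forall c d, C <= c -> size d = q ->
    g c (e :: d) = g C (e :: d).
  apply: (IHq (fun c d => g c (e :: d))) => [c|c d Mc dq].
    exact: ev_nonincreasing_cons.
  by apply: g_dec => //=; rewrite dq.
have [C gC] := choice slices.
pose D := maxn C1 (\max_(e < C1) C e).
have gD c e d : D <= c -> size d = q -> g c (e :: d) = g D (e :: d).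
  move=> Dc dq; have C1D : C1 <= D by exact: leq_maxl.
  have [C1e|eC1] := leqP C1 e; first by rewrite !diag // (leq_trans C1D).
  have CD : C e <= D.
    exact: leq_trans (leq_bigmax (Ordinal eC1)) (leq_maxr _ _).
  by rewrite gC ?(leq_trans CD) // -(gC _ D).
by exists D => c [//|e d] Dc [dq]; exact: gD.
Qed.

(** Weak compositions, with zero entries allowed: the possible multidegrees of a word of length
    [n]. *)
Fixpoint compositions (q n : nat) : seq (seq nat) :=
  if q is q'.+1 then
    flatten [seq map (cons c) (compositions q' (n - c)) | c <- iota 0 n.+1]
  else if n is 0 then [:: [::]] else [::].

Lemma compositionsS q n : compositions q.+1 n =
  flatten [seq [seq c :: d | d <- compositions q (n - c)] | c <- iota 0 n.+1].
Proof. by []. Qed.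

Lemma mem_compositions q n d :
  (d \in compositions q n) = (size d == q) && (sumn d == n).
Proof.
elim: q n d => [|q IHq] n d; first by case: n; case: d.
rewrite compositionsS; apply/flatten_mapP/andP => [[c]|[]].
  rewrite mem_iota add0n ltnS => /= cn /mapP[e]; rewrite IHq => /andP[/eqP <- /eqP ec] ->.
  by rewrite /= eqxx ec subnKC.
case: d => // c d; rewrite [size _]/= [sumn _]/= eqSS => dq /eqP <-.
exists c; first by rewrite mem_iota add0n ltnS leq_addr.
by rewrite map_f // IHq dq addKn /=.
Qed.

Lemma compositions_uniq q n : uniq (compositions q n).
Proof.
elim: q n => [|q IHq] n; first by case: n.
rewrite compositionsS; apply: allpairs_uniq_dep => [|c _|]; rewrite ?iota_uniq //.
by move=> [c d] [c' d'] _ _ /= [<- <-].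
Qed.

Lemma sum_compositionsS q n (g : seq nat -> nat) :
  \sum_(d <- compositions q.+1 n) g d =
  \sum_(0 <= c < n.+1) \sum_(d <- compositions q (n - c)) g (c :: d).
Proof.
rewrite compositionsS big_flatten big_map /index_iota subn0.
by apply: eq_bigr => c _; rewrite big_map.
Qed.

(** Induction on [q], sorting by the first entry [c]. The slices with [c < C] are finitely many
    shifted sequences; those with [c >= C] all use the function of slice [C], so together they form
    a partial sum. *)
Lemma ev_poly_compositions (M q : nat) (g : seq nat -> nat) :
  ev_nonincreasing M q g ->
  ev_poly (fun n => Posz (\sum_(d <- compositions q n) g d)).
Proof.
elim: q g => [|q IHq] g g_incr.
  apply: (ev_poly_ext (M := 1)) ev_poly0 => -[|n] //= _.
  by rewrite big_nil.
have [C gC] := @ev_nonincreasing_stable M q (fun c d => g (c :: d))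
  (fun c => @ev_nonincreasing_cons M q g c g_incr)
  (fun c d Mc dq => g_incr (c :: d) 0 (congr1 succn dq) isT Mc).
pose S c n := Posz (\sum_(d <- compositions q n) g (c :: d)).
have S_ev c : ev_poly (S c) by apply: IHq; exact: ev_nonincreasing_cons.
have tail_ev : ev_poly (fun n => \sum_(0 <= m < (n - C).+1) S C m)%R.
  exact: (ev_poly_shift C (ev_poly_psum (S_ev C))).
have head_ev : ev_poly (fun n => \sum_(c <- iota 0 C) S c (n - c)%N)%R.
  by apply: ev_poly_sum => c; exact: ev_poly_shift.
apply: (ev_poly_ext (M := C)) (ev_polyD head_ev tail_ev) => n Cn.
have PoszS := big_morph Posz PoszD (erefl (Posz 0)).
rewrite sum_compositionsS (@big_cat_nat _ _ _ C 0 n.+1 xpredT _ isT (leqW Cn)) /=.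
rewrite PoszD !PoszS; congr (_ + _)%R.
  by rewrite /index_iota subn0.
(* Reversing the tail replaces [c] by [m = n - c], which matches the partial sum of [S C]. *)
rewrite -[in RHS](add0n C) [in RHS]big_addn (subSn Cn) 2!big_mkord.
rewrite [RHS](reindex_inj rev_ord_inj) /=.
apply: eq_bigr => m _; congr Posz; rewrite subSS.
have mC : m <= n - C by rewrite -ltnS.
have -> : n - (n - C - m + C) = m.
  by rewrite addnC subnDA subKn.
rewrite [LHS]big_seq [RHS]big_seq; apply: eq_bigr => d.
by rewrite mem_compositions => /andP[/eqP dq _]; rewrite (gC _ _ _ dq) ?leq_addl.
Qed.

End Compositions.

(** * Words in a quandle up to braiding *)

Lemma sumn_incr_nth d j : sumn (incr_nth d j) = (sumn d).+1.
Proof.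
elim: d j => [|c d IHd] [|j] //=; last by rewrite IHd addnS.
by elim: j => //= j ->.
Qed.

Section Words.
Local Open Scope nat_scope.
Variable Q : finQuandleType.
Implicit Types (x y : Q) (u v w : seq Q).

Lemma qop_inj x : injective (qop x).
Proof. exact: bij_inj (qop_bij x). Qed.

Definition qperm x : {perm Q} := perm (@qop_inj x).
(** [qop_bij] only asserts that an inverse exists; since [Q] is finite, [phi_x] is a permutation and
    its inverse is available as data. *)
Definition qinv x : Q -> Q := (qperm x)^-1%g.

Lemma qopK x : cancel (qop x) (qinv x).
Proof. by move=> y; rewrite /qinv -[qop x y](permE (@qop_inj x)) permK. Qed.

Lemma qinvK x : cancel (qinv x) (qop x).
Proof. by move=> y; rewrite /qinv -[LHS](permE (@qop_inj x)) permKV. Qed.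

Lemma qinvxx x : qinv x x = x.
Proof. by rewrite -{2}[x]qopxx qopK. Qed.

(* Two words are related when they are colorings of the tops of two diagrams
   differing by a braid. *)
Inductive weq : seq Q -> seq Q -> Prop :=
  | weq_refl w : weq w w
  | weq_sym w w' : weq w w' -> weq w' w
  | weq_trans w w' w'' : weq w w' -> weq w' w'' -> weq w w''
  | weq_swap u x y v : weq (u ++ x :: y :: v) (u ++ qop x y :: x :: v).

Lemma weq_catl t w w' : weq w w' -> weq (t ++ w) (t ++ w').
Proof.
elim=> {w w'}; [by constructor|by constructor| |].
  by move=> w w' w'' _ ww' _; exact: weq_trans.
by move=> u x y v; rewrite !catA; exact: weq_swap.
Qed.

Lemma weq_cons x w w' : weq w w' -> weq (x :: w) (x :: w').
Proof. exact: (@weq_catl [:: x]). Qed.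

Lemma weq_size w w' : weq w w' -> size w = size w'.
Proof.
elim=> {w w'} [||w w' w'' _ -> _ ->|u x y v] //.
by rewrite !size_cat.
Qed.

(** Moving left, [x] keeps its value and each letter it overtakes is acted on by the inverse of
    [phi_x]: for [y = ^x z] the swap reads [y x ~ x z]. *)
Lemma weq_move_front x u v : weq (u ++ x :: v) (x :: map (qinv x) u ++ v).
Proof.
elim: u => [|y u IHu] /=; first exact: weq_refl.
apply: weq_trans (weq_cons y IHu) _.
apply: weq_sym; rewrite -{2}(qinvK x y).
exact: (@weq_swap [::]).
Qed.

(** The inverse of [phi_x] fixes [x] and is injective, so overtaking neither creates nor destroys
    another occurrence of [x]. *)
Lemma weq_pull x w m : count_mem x w = m.+1 ->
  exists2 w', weq w (x :: w') & count_mem x w' = m.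
Proof.
move=> xw; have /splitPr xw' : x \in w by rewrite -has_pred1 has_count xw.
case: xw' xw => u v; rewrite count_cat /= eqxx addnCA => -[]; rewrite add0n => uv.
exists (map (qinv x) u ++ v); first exact: weq_move_front.
rewrite count_cat count_map -uv; congr (_ + _). apply: eq_count => y /=.
by rewrite -[X in _ == X](qinvxx x) (can_eq (qinvK x)).
Qed.

Lemma weq_pulln x w k m : count_mem x w = k + m ->
  exists2 w', weq w (nseq k x ++ w') & count_mem x w' = m.
Proof.
elim: k w => [|k IHk] w; first by exists w => //; exact: weq_refl.
move=> /weq_pull[w1 ww1 /IHk[w' w1w' w'm]]; exists w' => //.
exact: weq_trans ww1 (weq_cons x w1w').
Qed.

(** An exponent [k] with [phi_x^k = id] for all [x] at once. *)
Definition qexp : nat := #|[set: {perm Q}]%SET|.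

Lemma qexp_gt0 : 0 < qexp.
Proof. by rewrite /qexp cardG_gt0. Qed.

Lemma iter_qexp x y : iter qexp (qop x) y = y.
Proof.
have : ((qperm x) ^+ qexp = 1)%g by apply: (@expg_cardG _ [set: {perm Q}]%G); rewrite inE.
move=> /permP/(_ y); rewrite permX perm1 => {2}<-.
by apply: eq_iter => z; rewrite permE.
Qed.

Lemma weq_nseq_cons x y j v :
  weq (nseq j x ++ y :: v) (iter j (qop x) y :: nseq j x ++ v).
Proof.
elim: j => [|j IHj] /=; first exact: weq_refl.
apply: weq_trans (weq_cons x IHj) _; exact: (@weq_swap [::]).
Qed.

Lemma weq_cons_nseq x y j v :
  weq (y :: nseq j x ++ v) (nseq j (qop y x) ++ y :: v).
Proof.
elim: j => [|j IHj] /=; first exact: weq_refl.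
apply: weq_trans (weq_cons _ IHj).
exact: (@weq_swap [::]).
Qed.

(* [x^k] is central for [k = qexp], so conjugating it by a letter [y] of [w]
   amounts to pulling [y] out of [w] and moving it across. *)
Lemma weq_conj_qexp x y w : y \in w ->
  weq (nseq qexp x ++ w) (nseq qexp (qop y x) ++ w).
Proof.
move=> /splitPr[u v].
apply: weq_trans (weq_catl _ (weq_move_front y u v)) _.
apply: weq_trans (weq_nseq_cons _ _ _ _) _; rewrite iter_qexp.
apply: weq_trans (weq_cons_nseq _ _ _ _) _.
exact/weq_catl/weq_sym/weq_move_front.
Qed.

(** Symmetrized so that [connect] is an equivalence; its classes are the orbits on [Q] of the group
    generated by the [phi_y] with [y] in [w]. *)
Definition adj w : rel Q :=
  [rel a b | has (fun y => (qop y a == b) || (qop y b == a)) w].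

Lemma adj_sym w : connect_sym (adj w).
Proof.
apply: sym_connect_sym => a b; apply: eq_has => y.
by rewrite orbC.
Qed.

Lemma adjP w a b : reflect (exists2 y, y \in w & qop y a = b \/ qop y b = a) (adj w a b).
Proof.
apply: (iffP hasP) => -[y yw].
  by move=> /orP[] /eqP yab; exists y => //; [left|right].
by move=> [] <-; exists y; rewrite ?eqxx ?orbT.
Qed.

Lemma connect_qop w y a : y \in w -> connect (adj w) a (qop y a).
Proof. by move=> yw; apply/connect1/adjP; exists y => //; left. Qed.

(** A partition is encoded by the map to chosen representatives of its parts. The choice depends
    only on the connectedness relation, so equal partitions give equal functions, and they range
    over a finite type. *)
Definition part w : {ffun Q -> Q} := [ffun a => fingraph.root (adj w) a].

Lemma part_eqP w a b : reflect (part w a = part w b) (connect (adj w) a b).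
Proof. by rewrite -(root_connect (adj_sym w)) !ffunE; exact: eqP. Qed.

Lemma part_qop w y a : y \in w -> part w (qop y a) = part w a.
Proof. by move=> /(connect_qop a)/part_eqP. Qed.

Lemma part_idem w a : part w (part w a) = part w a.
Proof. by rewrite !ffunE root_root //; exact: adj_sym. Qed.

Lemma connect_adjW w w' :
  (forall y a, y \in w -> connect (adj w') a (qop y a)) ->
  subrel (connect (adj w)) (connect (adj w')).
Proof.
move=> ww'; apply: connect_sub => a b /adjP[y yw [] <-]; last rewrite adj_sym.
  exact: ww'.
exact: ww'.
Qed.

Lemma part_eq w w' :
  (forall y a, y \in w -> connect (adj w') a (qop y a)) ->
  (forall y a, y \in w' -> connect (adj w) a (qop y a)) ->
  part w = part w'.
Proof.
move=> ww' w'w; apply/ffunP => a; rewrite !ffunE /fingraph.root; congr odflt.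
by apply: eq_pick => b; apply/idP/idP; exact: connect_adjW.
Qed.

(* Along a path from [y] to [x], the map [qop x] is a conjugate of [qop y] by maps
   [qop c] with [c] a letter of [w]. *)
Lemma connect_qop_conj w x y a : y \in w -> connect (adj w) y x ->
  connect (adj w) a (qop x a).
Proof.
move=> yw /connectP[p]; elim/last_ind: p x a => [|p z IHp] x a.
  by move=> _ ->; exact: connect_qop.
rewrite rcons_path last_rcons => /andP[yp pz] ->.
have {}IHp b : connect (adj w) b (qop (last y p) b) by exact: IHp.
have inv b c : c \in w -> connect (adj w) b (qinv c b).
  by move=> cw; rewrite adj_sym -{2}(qinvK c b); exact: connect_qop.
move: pz => /adjP[c cw []].
  move=> <-; rewrite -[a](qinvK c) -qopD.
  apply: (connect_trans (y := qinv c a)).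
    by rewrite adj_sym; apply: connect_qop.
  exact: connect_trans (IHp _) (connect_qop _ cw).
move=> zE; rewrite -[X in connect _ _ X](qopK c) qopD zE.
apply: connect_trans (inv _ _ cw).
exact: connect_trans (connect_qop _ cw) (IHp _).
Qed.

(** By [connect_qop_conj] the map [phi_x] already preserves every part, so the letter [x] merges
    nothing. *)
Lemma part_cons w x y : y \in w -> connect (adj w) y x -> part (x :: w) = part w.
Proof.
move=> yw xy; apply: part_eq => z a.
  rewrite inE => /predU1P[->|]; first exact: connect_qop_conj xy.
  exact: connect_qop.
by move=> zw; apply: connect_qop; rewrite inE zw orbT.
Qed.

(** A swap changes [y] into [^x y], which is connected to [y] because [x] is a letter of both words.
    By [connect_qop_conj] the letters of either word then act inside the parts of the other. *)
Lemma part_weq w w' : weq w w' -> part w = part w'.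
Proof.
elim=> {w w'} [||w w' w'' _ -> _ ->|u x y v] //.
set s := u ++ _; set t := u ++ _.
have sx : x \in s by rewrite mem_cat !inE eqxx !orbT.
have sy : y \in s by rewrite mem_cat !inE eqxx !orbT.
have tx : x \in t by rewrite mem_cat !inE eqxx !orbT.
have ty : qop x y \in t by rewrite mem_cat !inE eqxx !orbT.
apply: part_eq => z a; rewrite mem_cat !inE => /or4P[zu|/eqP->|/eqP->|zv].
- by apply: connect_qop; rewrite mem_cat zu.
- exact: connect_qop.
- by apply: (connect_qop_conj _ ty); rewrite adj_sym; exact: connect_qop.
- by apply: connect_qop; rewrite mem_cat !inE zv !orbT.
- by apply: connect_qop; rewrite mem_cat zu.
- by apply: (connect_qop_conj _ sy); exact: connect_qop.
- exact: connect_qop.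
- by apply: connect_qop; rewrite mem_cat !inE zv !orbT.
Qed.

Definition degree (p : {ffun Q -> Q}) w i : nat := count (fun y => p y == i) w.

Lemma degree_weq w w' i : weq w w' -> degree (part w) w i = degree (part w) w' i.
Proof.
elim=> {w w'} [//|w w' ww' IH|w w' w'' ww' IH w'w'' IH'|u x y v].
- by rewrite -(part_weq ww') -IH.
- by rewrite IH (part_weq ww').
rewrite /degree !count_cat /= part_qop ?mem_cat ?inE ?eqxx ?orbT //.
by rewrite [X in _ + X]addnCA.
Qed.

(** Indexed by all of [Q], so that the length does not depend on [p]; entries outside the image of
    [p] are zero. *)
Definition deg_seq (p : {ffun Q -> Q}) w : seq nat := map (degree p w) (enum Q).

Lemma sumn_deg_seq p w : sumn (deg_seq p w) = size w.
Proof.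
rewrite /deg_seq sumnE big_map big_enum /=.
under eq_bigr do rewrite /degree -sum1_count.
under eq_bigr do rewrite big_mkcond /=.
rewrite exchange_big /= -sum1_size; apply: eq_bigr => y _.
by rewrite -big_mkcond /= (big_pred1 (p y)) // => i; rewrite eq_sym.
Qed.

Lemma pigeonhole_degree p w i k : #|Q| * k < degree p w i ->
  exists x, p x = i /\ k < count_mem x w.
Proof.
move=> kw; apply: contrapT => no_x; move: kw; rewrite ltnNge => /negP; apply.
have le_k x : (p x == i) * count_mem x w <= k.
  case: eqP => [px|_]; rewrite ?mul0n // mul1n leqNgt; apply/negP => kx.
  by apply: no_x; exists x.
rewrite -sum_nat_const.
apply: leq_trans (_ : \sum_x (p x == i) * count_mem x w <= _); last by apply: leq_sum.
rewrite /degree; elim: w {le_k no_x} => [|y w IHw] //=.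
under eq_bigr do rewrite mulnDr.
rewrite big_split /= leq_add // (bigD1 y) //= eqxx muln1.
exact: leq_addr.
Qed.
Lemma part_nseq w x y j : y \in w -> connect (adj w) y x ->
  part (nseq j x ++ w) = part w.
Proof.
move=> yw yx; elim: j => [//|j IHj] /=.
rewrite (@part_cons _ x y) ?mem_cat ?yw ?orbT //.
by apply/part_eqP; rewrite IHj; exact/part_eqP.
Qed.

(** The conjugation of [weq_conj_qexp] is repeated along a path, and reversed on the edges that
    point backwards. *)
Lemma weq_connect_qexp w x y : connect (adj w) x y ->
  weq (nseq qexp x ++ w) (nseq qexp y ++ w).
Proof.
move=> /connectP[p]; elim: p x => [|z p IHp] x /=; first by move=> _ ->; exact: weq_refl.
move=> /andP[/adjP[c cw xz] zp] yE; apply: weq_trans (IHp _ zp yE).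
by case: xz => <-; [|apply: weq_sym]; exact: weq_conj_qexp.
Qed.

(** * Counting classes of words *)

Definition canon w : seq Q := choose (fun w' => `[< weq w w' >]) w.

Lemma weq_canon w : weq w (canon w).
Proof. by apply/asboolP/(@chooseP _ (fun w' => `[< weq w w' >]))/asboolP/weq_refl. Qed.

Lemma canon_eqP w w' : canon w = canon w' <-> weq w w'.
Proof.
split=> [ww'|ww'].
  by apply: weq_trans (weq_canon w) _; rewrite ww'; exact/weq_sym/weq_canon.
(* [choose] depends only on the extension of its predicate, and not on the starting word once that
   word satisfies it. *)
rewrite /canon (@eq_choose _ _ (fun s => `[< weq w' s >])) => [|s].
  by apply: choose_id; apply/asboolP; [exact: weq_sym|exact: weq_refl].
by apply/asboolP/asboolP; apply: weq_trans => //; exact: weq_sym.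
Qed.

Lemma canonK w : canon (canon w) = canon w.
Proof. exact/canon_eqP/weq_sym/weq_canon. Qed.

Lemma size_canon w : size (canon w) = size w.
Proof. exact/esym/weq_size/weq_canon. Qed.

Definition classes n : seq (seq Q) :=
  undup [seq canon (val t) | t <- enum {: n.-tuple Q}].

Lemma mem_classes n w : (w \in classes n) = (size w == n) && (canon w == w).
Proof.
rewrite mem_undup; apply/mapP/andP => [[t _ ->]|[wn /eqP wE]].
  by rewrite size_canon size_tuple canonK !eqxx.
by exists (Tuple wn); rewrite ?mem_enum //= wE.
Qed.

(** The multidegree determines the length of the words as its sum. *)
Definition num_classes (p : {ffun Q -> Q}) (d : seq nat) : nat :=
  count (fun w => (part w == p) && (deg_seq p w == d)) (classes (sumn d)).

(** Surjectivity of prefixing gives the inequality: each class counted on the left is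
    [canon (i :: u)] with [u] counted on the right. Past [#|Q| * qexp], the pigeonhole principle
    yields a letter occurring more than [qexp] times. *)
Lemma num_classes_nonincreasing p :
  ev_nonincreasing (#|Q| * qexp) #|Q| (num_classes p).
Proof.
move=> d j dQ jQ dj; set i := enum_val (Ordinal jQ).
have nth_i : nth i (enum Q) j = i by rewrite /i {2}(enum_val_nth i).
rewrite /num_classes -!size_filter.
rewrite -[leqRHS](size_map (fun w => canon (i :: w))).
apply: uniq_leq_size => [|t]; first by rewrite filter_uniq ?undup_uniq.
rewrite mem_filter mem_classes => /andP[/andP[/eqP pt /eqP dt] /andP[/eqP st /eqP ct]].
have degt l : l < #|Q| -> degree p t (nth i (enum Q) l) = (j == l) + nth 0 d l.
  by move=> lQ; rewrite -nth_incr_nth -dt [RHS](nth_map i) -?cardE.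
have [x [px kx]] : exists x, p x = i /\ qexp < count_mem x t.
  by apply: pigeonhole_degree; rewrite -nth_i degt // eqxx.
(* [qexp] copies of [x] are pulled out and at least one stays in [w']; this keeps the partition,
   hence [x] connected to [i], so that [x^qexp] can be turned into [i^qexp]. *)
have := subnKC kx; rewrite addSnnS => /esym/weq_pulln[w' tw' xw'].
have {}xw' : x \in w' by rewrite -has_pred1 has_count xw'.
have pw' : part w' = p.
  by rewrite -pt (part_weq tw'); apply/esym/(part_nseq _ xw').
have xi : connect (adj w') x i.
  by apply/part_eqP; rewrite -px -pw' part_idem.
pose u := nseq qexp.-1 i ++ w'.
have tu : weq t (i :: u).
  have -> : i :: u = nseq qexp i ++ w' by rewrite -[in RHS](prednK qexp_gt0).
  exact: weq_trans tw' (weq_connect_qexp xi).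
have pu : part u = p by rewrite -pw'; exact: part_nseq xi.
have su : size u = sumn d.
  by apply/succn_inj; rewrite -/(size (i :: u)) -(weq_size tu) st sumn_incr_nth.
have du : deg_seq p u = d.
  apply: (@eq_from_nth _ 0) => [|l]; first by rewrite size_map -cardE.
  rewrite size_map -cardE => lQ; rewrite [LHS](nth_map i) -?cardE //.
  have := degt l lQ; rewrite -pt (degree_weq _ tu) pt /degree /=.
  have -> : p i = i by rewrite -px -pw' part_idem.
  rewrite -{1}nth_i nth_uniq ?enum_uniq -?cardE //; exact: addnI.
apply/mapP; exists (canon u).
  rewrite mem_filter mem_classes size_canon canonK su !eqxx !andbT.
  rewrite -(part_weq (weq_canon u)) pu eqxx /= -du -pu; apply/eqP/eq_map => l.
  exact/esym/degree_weq/weq_canon.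
rewrite -{1}ct; apply/canon_eqP; apply: weq_trans tu _.
exact/weq_cons/weq_canon.
Qed.

(** Every class has exactly one partition and one degree sequence, so the double sum counts it
    once. *)
Lemma size_classes n :
  size (classes n) = \sum_p \sum_(d <- compositions #|Q| n) num_classes p d.
Proof.
have sz_deg p w : size w = n -> deg_seq p w \in compositions #|Q| n.
  by move=> wn; rewrite mem_compositions sumn_deg_seq wn size_map -cardE !eqxx.
transitivity (\sum_p \sum_(d <- compositions #|Q| n) \sum_(w <- classes n)
    ((part w == p) && (deg_seq p w == d) : nat)); last first.
  apply: eq_bigr => p _; rewrite [RHS]big_seq [LHS]big_seq; apply: eq_bigr => d.
  rewrite mem_compositions => /andP[_ /eqP dn].
  by rewrite /num_classes dn -sum1_count [RHS]big_mkcond.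
under eq_bigr do rewrite exchange_big.
rewrite exchange_big /= -sum1_size big_seq [RHS]big_seq; apply: eq_bigr => w.
rewrite mem_classes => /andP[/eqP wn _].
rewrite (bigD1 (part w)) //= [X in _ + X]big1 ?addn0 => [|p /negPf pw]; last first.
  by rewrite big1 // => d _; rewrite eq_sym pw.
rewrite (bigD1_seq (deg_seq (part w) w)) ?sz_deg ?compositions_uniq //= !eqxx.
by rewrite big1 ?addn0 // => d /negPf; rewrite eq_sym => ->.
Qed.

Lemma ev_poly_classes : ev_poly (fun n => Posz (size (classes n))).
Proof.
have PoszS := big_morph Posz PoszD (erefl (Posz 0)).
pose F p n := Posz (\sum_(d <- compositions #|Q| n) num_classes p d).
have F_ev p : ev_poly (F p).
  exact: ev_poly_compositions (num_classes_nonincreasing p).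
apply: (ev_poly_ext (M := 0)) (ev_poly_sum (index_enum _) F_ev) => n _.
by rewrite size_classes PoszS.
Qed.
End Words.

(** * Integration over a profinite completion *)

Section ProfiniteIntegral.
Local Open Scope classical_set_scope.
Local Open Scope group_scope.
Variable G : groupType.
Implicit Types (N M : finite_index_normal G) (x : profinite_completion G).

Let coset_prod : topologicalType :=
  prod_topology (fun _ : finite_index_normal G => discrete_topology (set G)).

Lemma coset_at_continuous : continuous
  (@coset_at G : profinite_completion G -> coset_prod).
Proof. exact: initial_continuous. Qed.

Lemma nbhs_coset_prod N (f : coset_prod) : nbhs f [set h : coset_prod | h N = f N].
Proof.
have := @proj_continuous (finite_index_normal G) (fun=> discrete_topology (set G)) N f.
by move=> /(_ _ (@discrete_set1 (discrete_topology (set G)) (f N))).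
Qed.

Lemma open_coset_at N (K : set G) : open [set x | coset_at x N = K].
Proof.
rewrite openE => x <-; exact: (@coset_at_continuous x _
  (nbhs_coset_prod N (coset_at x))).
Qed.

(** A coset of the intersection is the intersection of a coset of [N] and one of [M]. *)
Fact finI_index N M : finite_set (range (gcoset (N `&` M))).
Proof.
pose f (KL : set G * set G) := KL.1 `&` KL.2.
apply: (@sub_finite_set _ _ (f @` (range (gcoset N) `*` range (gcoset M)))).
  move=> _ [g _ <-]; exists (gcoset N g, gcoset M g); first by split; exists g.
  apply/seteqP; split=> [y [/gcosetP Ny /gcosetP My]|_ [y [Ny My] <-]].
    by exists (g^-1 * y); rewrite ?mulVKg.
  by split; exists y.
by apply: finite_image; apply: finite_setX; exact: fin_index.
Qed.

Definition finI_normal N M : finite_index_normal G := {|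
  fin_carrier := N `&` M;
  fin_1 := conj (fin_1 N) (fin_1 M);
  fin_M := fun a b ab bb => conj (fin_M ab.1 bb.1) (fin_M ab.2 bb.2);
  fin_V := fun a aNM => conj (fin_V aNM.1) (fin_V aNM.2);
  fin_J := fun a b aNM => conj (fin_J b aNM.1) (fin_J b aNM.2);
  fin_index := finI_index N M |}.

(** Group elements congruent to [x] modulo smaller and smaller [N]: a filter carried by the image of
    [G] and converging to [x], which expresses density. By compatibility the union is just
    [coset_at x N]; written this way, it is visibly monotone in [N]. *)
Definition approx x : set_system (profinite_completion G) :=
  filter_from [set: finite_index_normal G]
    (fun N => [set of_group g | g in
       \bigcup_(M in [set M : finite_index_normal G | M `<=` N]) coset_at x M]).

Lemma approx_filter (N0 : finite_index_normal G) x : ProperFilter (approx x).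
Proof.
apply: filter_from_proper.
  apply: filter_from_filter; first by exists N0.
  move=> N M _ _; exists (finI_normal N M) => // _ [g [L /= LNM gL] <-].
  by split; exists g => //; exists L => //= y /LNM[].
move=> N _; have [g _ gN] := coset_atP x N.
by exists (of_group g), g => //; exists N => //=; rewrite -gN; exact: gcoset_id.
Qed.

Lemma coset_at_gcoset x N g : coset_at x N g -> coset_at x N = gcoset N g.
Proof.
have [h _ <-] := coset_atP x N => -[n Nn <-].
apply/seteqP; split=> y /gcosetP Nhy; apply/gcosetP.
  by rewrite invMg -mulgA; apply: fin_M => //; exact: fin_V.
rewrite -[h^-1 * y](mulVKg n); apply: fin_M => //.
  by rewrite mulgA -invgM.
Qed.

Lemma approx_cvg (N0 : finite_index_normal G) x : approx x --> x.
Proof.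
have FF := approx_filter N0 x.
move=> A /=; rewrite nbhsE => -[_ [[B oB <-] Bx] BA].
have cvg_prod : (@coset_at G @ approx x) --> (coset_at x : coset_prod).
  have FF' : Filter (@coset_at G @ approx x) by exact: fmap_filter.
  apply/cvg_sup => N U; rewrite nbhsE => -[_ [[C _ <-] /= Cx] CU].
  exists N => // _ [g [M /= MN gM] <-] /=; apply: CU => /=.
  by rewrite -(coset_at_gcoset (coset_at_compat MN gM)).
have : nbhs (coset_at x : coset_prod) B by rewrite nbhsE; exists B.
by move=> /cvg_prod; exact: (@filterS _ (approx x) _ _ _ BA).
Qed.

(** * Extending a homomorphism to a finite group *)

Variables (hT : finGroupType) (phi : G -> hT).
Hypothesis phiM : {morph phi : g h / g * h}.

Lemma hom1 : phi 1 = 1.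
Proof. by apply: (mulgI (phi 1)); rewrite -phiM !mulg1. Qed.

Lemma homV g : phi g^-1 = (phi g)^-1.
Proof. by apply: (mulgI (phi g)); rewrite -phiM !mulgV hom1. Qed.

Fact hom_ker_index : finite_set (range (gcoset [set g | phi g = 1])).
Proof.
apply: (@sub_finite_set _ _ ((fun h => [set g | phi g = h]) @` [set: hT])).
  move=> _ [g _ <-]; exists (phi g) => //; apply/seteqP; split=> y /=.
    by move=> yg; exists (g^-1 * y); rewrite ?mulVKg //= phiM homV yg mulVg.
  by move=> [z /= z1 <-]; rewrite phiM z1 mulg1.
by apply: finite_image.
Qed.

Definition hom_ker : finite_index_normal G.
Proof.
refine (@FiniteIndexNormal _ [set g | phi g = 1] hom1 _ _ _ hom_ker_index) => /=.
- by move=> g h; rewrite phiM => -> ->; rewrite mulg1.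
- by move=> g; rewrite homV => ->; rewrite invg1.
- by move=> g h g1; rewrite !phiM g1 mulg1 homV mulVg.
Defined.

(** The representative modulo the kernel is immaterial, and the default [1] of [xget] is never
    reached because cosets are nonempty. *)
Definition hom_ext x : hT := phi (xget 1 (coset_at x hom_ker)).

Lemma hom_extE x g : coset_at x hom_ker g -> hom_ext x = phi g.
Proof.
move=> xg; have : coset_at x hom_ker (xget 1 (coset_at x hom_ker)) by apply: xgetPex; exists g.
rewrite (coset_at_gcoset xg) => /gcosetP /=; rewrite phiM homV => gE.
by rewrite /hom_ext (coset_at_gcoset xg); apply: (mulgI (phi g)^-1); rewrite gE mulVg.
Qed.

Lemma hom_ext_coset x g : hom_ext x = phi g -> coset_at x hom_ker = gcoset hom_ker g.
Proof.
have [h _ xh] := coset_atP x hom_ker.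
have {}xh : coset_at x hom_ker h by rewrite -xh; exact: gcoset_id.
rewrite (hom_extE xh) => hg; apply: coset_at_gcoset.
rewrite (coset_at_gcoset xh); apply/gcosetP => /=.
by rewrite phiM homV hg mulVg.
Qed.

(** Uniqueness by density: [c] takes the value [c x] at all group elements close to [x], and one of
    these can also be taken congruent to [x] modulo the kernel. *)
Lemma continuous_extensionE (F : hT -> nat) c :
  continuous_extension (F \o phi) c -> c = F \o hom_ext.
Proof.
move=> [c_cont cE]; apply/funext => x.
have FF := approx_filter hom_ker x.
have : c @ approx x --> c x by apply: cvg_trans (c_cont x); exact/cvg_app/(approx_cvg hom_ker).
rewrite (@discrete_cvg nat) => -[N _ /= cN].
have [g _ gN] := coset_atP x (finI_normal N hom_ker).
have xg : coset_at x (finI_normal N hom_ker) g by rewrite -gN; exact: gcoset_id.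
have <- : c (of_group g) = c x.
  by apply: (cN (of_group g)); exists g => //; exists (finI_normal N hom_ker) => // y [].
rewrite cE /=; congr F; apply/esym/hom_extE.
by apply: coset_at_compat xg => y [].
Qed.

Lemma hom_ext_of_group g : hom_ext (of_group g) = phi g.
Proof. by apply: hom_extE; exact: gcoset_id. Qed.

Lemma hom_extM x y : hom_ext (x * y) = hom_ext x * hom_ext y.
Proof.
have [g _ xg] := coset_atP x hom_ker; have [h _ yh] := coset_atP y hom_ker.
have {}xg : coset_at x hom_ker g by rewrite -xg; exact: gcoset_id.
have {}yh : coset_at y hom_ker h by rewrite -yh; exact: gcoset_id.
rewrite (hom_extE xg) (hom_extE yh) -phiM; apply: hom_extE.
by exists g => //; exists h.
Qed.

Definition hom_img : {set hT} := [set h | `[< exists g, phi g = h >]]%SET.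

Lemma mem_hom_img h : reflect (exists g, phi g = h) (h \in hom_img).
Proof. by rewrite inE; exact: asboolP. Qed.

Lemma hom_ext_img x : hom_ext x \in hom_img.
Proof. by apply/mem_hom_img; exists (xget 1 (coset_at x hom_ker)). Qed.

(** A fibre is either empty or given by one coset modulo the kernel, hence open. *)
Lemma measurable_hom_ext h :
  measurable ([set x | hom_ext x = h] : set (borel_profinite G)).
Proof.
apply: sub_sigma_algebra => /=.
have [/mem_hom_img[g gh]|hN] := boolP (h \in hom_img).
  have -> : [set x | hom_ext x = h] = [set x | coset_at x hom_ker = gcoset hom_ker g].
    apply/seteqP; split=> x /=; first by rewrite -gh; exact: hom_ext_coset.
    by move=> xg; rewrite -gh; apply: hom_extE; rewrite xg; exact: (gcoset_id hom_ker g).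
  exact: open_coset_at.
rewrite (_ : [set x | _] = set0); first exact: open0.
apply/seteqP; split=> x //= xh; move: hN; rewrite -xh.
by rewrite hom_ext_img.
Qed.

Variables (R : realType) (mu : probability (borel_profinite G) R).
Hypothesis mu_haar : normalized_haar mu.

(** Left translation by [g] carries the fibre over [1] onto the fibre over [phi g]. *)
Lemma haar_hom_ext g :
  mu [set x | hom_ext x = phi g] = mu [set x | hom_ext x = 1].
Proof.
rewrite -(mu_haar (of_group g) (measurable_hom_ext 1)); congr (mu _).
apply/seteqP; split=> [x /= xg|_ [x /= x1 <-]].
  exists ((of_group g)^-1 * x); last exact: mulVKg.
  apply: (mulgI (phi g)); rewrite mulg1 -[in RHS]xg -hom_ext_of_group -hom_extM.
  by rewrite mulVKg.
by rewrite hom_extM hom_ext_of_group x1 mulg1.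
Qed.

(** The integrand is a finite combination of indicators of fibres; those over the image have equal
    measure, and the others are empty. *)
Lemma integral_hom_ext_sum (F : hT -> nat) :
  (\int[mu]_x ((F (hom_ext x))%:R)%:E =
   ((\sum_(h in hom_img) F h)%:R)%:E * mu [set x | hom_ext x = 1%g])%E.
Proof.
pose A h : set (borel_profinite G) := [set x | hom_ext x = h].
transitivity (\int[mu]_x \sum_(h : hT) ((F h)%:R * \1_(A h) x)%R%:E)%E.
  apply: eq_integral => x _; rewrite (bigD1 (hom_ext x)) //= big1 => [|h hx].
    by rewrite indicE mem_set // mulr1 adde0.
  by rewrite indicE memNset ?mulr0 // => xh; rewrite -xh eqxx in hx.
rewrite ge0_integral_sum //=; last first.
  move=> h; apply/measurable_EFinP; apply: measurable_funM => //.
  exact: measurable_indic (measurable_hom_ext h).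
transitivity (\sum_(h : hT) (((F h)%:R)%:E * mu (A h)))%E.
  apply: eq_bigr => h _.
  rewrite (@integralZl_indic _ _ _ _ _ _ (fun=> A h)) //.
  - by rewrite integral_indic ?setIT //; exact: measurable_hom_ext.
  - by move=> /(le_lt_trans (ler0n _ _)); rewrite ltxx.
  - exact: measurable_hom_ext.
rewrite (bigID [in hom_img]) /= [X in (_ + X)%E]big1 ?adde0 => [|h hN]; last first.
  rewrite (_ : A h = set0) ?measure0 ?mule0 //; apply/seteqP; split=> x //= xh.
  by rewrite -xh hom_ext_img in hN.
rewrite natr_sum -sumEFin ge0_sume_distrl => [|h _]; last by rewrite lee_fin.
by apply: eq_bigr => h /mem_hom_img[g <-]; congr (_ * _)%E; exact: haar_hom_ext.
Qed.

Lemma integral_hom_ext (F : hT -> nat) :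
  (\int[mu]_x ((F (hom_ext x))%:R)%:E =
   ((\sum_(h in hom_img) F h)%:R / #|hom_img|%:R)%R%:E)%E.
Proof.
(* The constant function [1] shows that the common measure of the fibres is the inverse of the order
   of the image. *)
have := integral_hom_ext_sum (fun=> 1%N).
rewrite integral_hom_ext_sum sum1_card integral_cst //= mul1e.
rewrite [X in X = _](_ : _ = 1%E); last exact: probability_setT.
have : mu [set x | hom_ext x = 1] \is a fin_num.
  by apply: fin_num_measure; exact: measurable_hom_ext.
move=> /fineK <-; move: (fine _) => m.
rewrite -!EFinM => -[m1]; congr (_%:E); congr (_ * _)%R.
have img0 : (#|hom_img|%:R != 0 :> R)%R.
  by apply: contra_eq_neq m1 => ->; rewrite mul0r oner_neq0.
by rewrite -[LHS](mulKf img0) -m1 mulr1.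
Qed.

End ProfiniteIntegral.

(** * The action of braids on words *)

Section BraidAction.
Variables (Q : finQuandleType) (n : nat).
Implicit Types (i j : 'I_n.-1) (t : n.-tuple Q) (w : braid_word n).
Local Open Scope nat_scope.

Definition lft i : 'I_n := widen_ord (leq_pred n) i.

Fact rgt_subproof i : i.+1 < n.
Proof. by rewrite -ltn_predRL. Qed.

Definition rgt i : 'I_n := Ordinal (rgt_subproof i).

Lemma rgt_lft i : (rgt i == lft i) = false.
Proof. by rewrite -val_eqE /= gtn_eqF. Qed.

Lemma lft_rgt i : (lft i == rgt i) = false.
Proof. by rewrite eq_sym rgt_lft. Qed.

(** The coloring rule at a crossing, read downwards: the over-strand keeps its color, and the
    under-strand is acted on by [phi] of that color or by its inverse. *)
Definition letter_act (l : braid_letter n) t : n.-tuple Q :=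
  let tl := tnth t (lft l.1) in let tr := tnth t (rgt l.1) in
  [tuple if a == lft l.1 then if l.2 then qop tl tr else tr
         else if a == rgt l.1 then if l.2 then tl else qinv tr tl
         else tnth t a | a < n].

Lemma tnth_letter_act (l : braid_letter n) t a : tnth (letter_act l t) a =
  if a == lft l.1 then
    if l.2 then qop (tnth t (lft l.1)) (tnth t (rgt l.1)) else tnth t (rgt l.1)
  else if a == rgt l.1 then
    if l.2 then tnth t (lft l.1) else qinv (tnth t (rgt l.1)) (tnth t (lft l.1))
  else tnth t a.
Proof. exact: tnth_mktuple. Qed.

Lemma letter_actK i b : cancel (letter_act (i, b)) (letter_act (i, ~~ b)).
Proof.
move=> t; apply: eq_from_tnth => a; rewrite !tnth_letter_act /= !eqxx rgt_lft.
case: eqVneq => [->|_]; first by case: b; rewrite //= qinvK.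
by case: eqVneq => [->|//]; case: b; rewrite //= qopK.
Qed.

Lemma letter_act_inj l : injective (letter_act l).
Proof. by case: l => i b; exact: can_inj (letter_actK i b). Qed.

Definition letter_perm l : {perm n.-tuple Q} := perm (@letter_act_inj l).

(** Products of permutations apply the left factor first, so the letters act from top to bottom. *)
Definition word_perm w : {perm n.-tuple Q} := (\prod_(l <- w) letter_perm l)%g.

Lemma word_perm_cat u v : word_perm (u ++ v) = (word_perm u * word_perm v)%g.
Proof. exact: big_cat. Qed.

Lemma word_perm_cons l w t :
  word_perm (l :: w) t = word_perm w (letter_act l t).
Proof. by rewrite /word_perm big_cons permM permE. Qed.

Lemma word_perm0 t : word_perm [::] t = t.
Proof. by rewrite /word_perm big_nil perm1. Qed.

Lemma word_perm_eq u v : braid_eq u v -> word_perm u = word_perm v.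
Proof.
elim=> {u v}.
- by [].
- by move=> u v _ ->.
- by move=> u v w _ -> _ ->.
- by move=> u u' v v' _ uu' _ vv'; rewrite !word_perm_cat uu' vv'.
- move=> i b; apply/permP => t.
  by rewrite !word_perm_cons !word_perm0 letter_actK.
- move=> i j ji; apply/permP => t; rewrite !word_perm_cons !word_perm0.
  have jE : lft j = rgt i by apply/val_inj; rewrite /= ji.
  have ri_j : (rgt j == lft i) = false by rewrite -val_eqE /= ji gtn_eqF.
  have ri_i : (rgt j == rgt i) = false by rewrite -val_eqE /= ji gtn_eqF.
  have ir_j : (lft i == rgt j) = false by rewrite eq_sym.
  have ir_i : (rgt i == rgt j) = false by rewrite eq_sym.
  pose E := (rgt_lft, lft_rgt, jE, ri_j, ri_i, ir_j, ir_i, eqxx).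
  apply: eq_from_tnth => a; do !rewrite !tnth_letter_act /= !E.
  (* Of the three positions involved, only the leftmost needs self-distributivity. *)
  case: (eqVneq a (lft i)) => [->|ai]; rewrite ?E /=; first by rewrite [RHS]qopD.
  by case: (eqVneq a (rgt i)) => [_|ar]; rewrite ?E //; case: ifP.
- move=> i j ij; apply/permP => t; rewrite !word_perm_cons !word_perm0.
  have ne1 : (lft i == lft j) = false by rewrite -val_eqE /= ltn_eqF // (leq_trans _ ij).
  have ne2 : (lft i == rgt j) = false.
    by rewrite -val_eqE /= ltn_eqF // (leq_trans _ (leqW ij)).
  have ne3 : (rgt i == lft j) = false by rewrite -val_eqE /= ltn_eqF.
  have ne4 : (rgt i == rgt j) = false by rewrite -val_eqE /= ltn_eqF // (leq_trans ij).
  pose E := (ne1, ne2, ne3, ne4, rgt_lft, lft_rgt, eqxx).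
  have E1 : (lft j == lft i) = false by rewrite eq_sym.
  have E2 : (rgt j == lft i) = false by rewrite eq_sym.
  have E3 : (lft j == rgt i) = false by rewrite eq_sym.
  have E4 : (rgt j == rgt i) = false by rewrite eq_sym.
  apply: eq_from_tnth => a; do !rewrite !tnth_letter_act /= !(E, E1, E2, E3, E4).
  case: (eqVneq a (lft i)) => [->|ai]; rewrite ?(E, E1, E2, E3, E4) //=.
  by case: (eqVneq a (rgt i)) => [->|ar]; rewrite ?(E, E1, E2, E3, E4).
Qed.

Definition braid_perm (s : braid n) : {perm n.-tuple Q} := word_perm (generic_quotient.repr s).

Lemma braid_permM : {morph braid_perm : s s' / (s * s')%g}.
Proof.
by move=> s s'; rewrite /braid_perm -word_perm_cat; apply/word_perm_eq/repr_braid.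
Qed.

Lemma braid_perm_pi w : braid_perm (\pi_(braid n) w)%qT = word_perm w.
Proof. exact/word_perm_eq/repr_braid. Qed.

Lemma letter_act_swap i t u x y v : val t = u ++ x :: y :: v -> size u = i ->
  val (letter_act (i, true) t) = u ++ qop x y :: x :: v.
Proof.
move=> tE ui; have tn := size_tuple t.
have nthE (a : 'I_n) : tnth t a = nth x (u ++ x :: y :: v) a by rewrite -tE -tnth_nth.
apply: (@eq_from_nth _ x) => [|a].
  by rewrite size_tuple -(size_tuple t) tE !size_cat.
rewrite size_tuple => an; rewrite -[a]/(val (Ordinal an)) -tnth_nth tnth_letter_act /=.
rewrite !nthE /= -!val_eqE /= -ui !nth_cat ltnn ltnNge leqnSn /= subnn subSnn /=.
case: ltngtP => [au|au|->]; last by rewrite subnn.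
  by rewrite ltn_eqF // leqW.
case: eqVneq => [->|au1]; first by rewrite subSnn.
have {au1} au2 : (size u).+1 < a by rewrite ltn_neqAle eq_sym au1.
by rewrite -(subnKC au2) addSnnS addSnnS addKn.
Qed.

Definition braid_img : {set {perm n.-tuple Q}} := hom_img braid_perm.

Lemma braid_img_group : group_set braid_img.
Proof.
apply/group_setP; split.
  by apply/mem_hom_img; exists 1%g; exact: hom1 braid_permM.
move=> _ _ /mem_hom_img[g <-] /mem_hom_img[h <-]; apply/mem_hom_img.
by exists (g * h)%g; rewrite braid_permM.
Qed.

Canonical braid_img_groupType := Group braid_img_group.

Lemma weq_letter_act l t : weq t (letter_act l t).
Proof.
have pos i (s : n.-tuple Q) : weq s (letter_act (i, true) s).
  have si : i.+1 < size s by rewrite size_tuple -ltn_predRL.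
  have x := tnth s (lft i).
  have sE : val s = take i s ++ nth x s i :: nth x s i.+1 :: drop i.+2 s.
    by rewrite -(drop_nth x si) -(drop_nth x (ltnW si)) cat_take_drop.
  rewrite (letter_act_swap sE); last by rewrite size_take (ltnW si).
  by rewrite [X in weq X]sE; exact: weq_swap.
case: l => i [|]; first exact: pos.
(* For an inverse letter, [t] is recovered from its image by the positive letter. *)
by rewrite -{1}(letter_actK i false t); exact/weq_sym/pos.
Qed.

Lemma weq_word_perm w t : weq t (word_perm w t).
Proof.
elim: w t => [|l w IHw] t; first by rewrite word_perm0; exact: weq_refl.
by rewrite word_perm_cons; apply: weq_trans (weq_letter_act l t) (IHw _).
Qed.

(** Symmetry and transitivity of [weq] correspond to inverses and products in [braid_img], and a
    swap to a generator. *)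
Lemma weq_braid_img (s s' : seq Q) : weq s s' -> forall t, val t = s ->
  exists2 h, h \in braid_img & val (h t) = s'.
Proof.
elim=> {s s'}.
- by move=> s t ts; exists 1%g; rewrite ?group1 // perm1.
- move=> s s' ss' IH t ts'.
  have sn : size s == n by rewrite (weq_size ss') -ts' size_tuple.
  have [h hH hE] := IH (Tuple sn) erefl.
  exists h^-1%g; rewrite ?groupV //.
  have -> : t = h (Tuple sn) by apply: val_inj; rewrite hE.
  by rewrite permK.
- move=> s s' s'' _ IH _ IH' t /IH[h hH /IH'[h' h'H hE]].
  by exists (h * h')%g; rewrite ?groupM // permM.
move=> u x y v t tE.
have un : size u < n.-1.
  by rewrite ltn_predRL -(size_tuple t) tE size_cat /= !addnS !ltnS leq_addr.
exists (word_perm [:: (Ordinal un, true)]).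
  apply/mem_hom_img; exists (\pi_(braid n) [:: (Ordinal un, true)])%qT.
  exact: braid_perm_pi.
by rewrite word_perm_cons word_perm0; exact: letter_act_swap tE _.
Qed.

Lemma orbit_weqP t t' :
  orbit 'P braid_img t = orbit 'P braid_img t' <-> weq t t'.
Proof.
split=> [/orbit_eqP/orbitP[h /mem_hom_img[s <-] <-]|/weq_braid_img/(_ t erefl)[h hH ht]].
  exact/weq_sym/weq_word_perm.
by apply/esym/orbit_eqP/orbitP; exists h => //; exact: val_inj.
Qed.

(** Orbits and canonical words are functions of a tuple with the same fibres, so they take equally
    many values. *)
Lemma card_braid_orbits : #|orbit 'P braid_img @: [set: n.-tuple Q]%SET| = size (classes Q n).
Proof.
have undup_eq (T U V : eqType) (f : T -> U) (g : T -> V) (s : seq T) :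
    (forall x y, f x = f y <-> g x = g y) -> size (undup (map f s)) = size (undup (map g s)).
  move=> fg; elim: s => //= x s IHs.
  have -> : (f x \in map f s) = (g x \in map g s).
    by apply/mapP/mapP => -[y ys] /fg; exists y.
  by case: ifP => //= _; rewrite IHs.
rewrite -(undup_eq _ _ _ (orbit 'P braid_img)) => [|t t']; last first.
  by rewrite canon_eqP; exact: orbit_weqP.
rewrite -(card_uniqP (undup_uniq _)); apply: eq_card => X.
rewrite mem_undup; apply/imsetP/mapP => -[t _ ->]; exists t => //.
by rewrite mem_enum.
Qed.

(** Burnside's lemma for the action of the finite image on [Q^n]. *)
Lemma sum_card_fix_braid :
  \sum_(h in braid_img) #|[set t | h t == t]%SET| = size (classes Q n) * #|braid_img|.
Proof.
rewrite -card_braid_orbits.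
have := Frobenius_Cauchy (to := 'P) (G := [group of braid_img]) (S := [set: n.-tuple Q]%SET).
move=> <- //=; last by apply/actsP => h _ t; rewrite !inE.
apply: eq_bigr => h _; apply: eq_card => t.
by rewrite [RHS]finset.in_setI finset.in_setT inE; apply/eqP/afix1P.
Qed.
End BraidAction.

(** * Colorings of braid closures *)

Section DiagramColoring.
Variables (D : diagram) (Q : finQuandleType).

Definition gen (a : diagram_arc D) : fund_quandle D := (\pi_(fund_quandle D) (QGen a))%qT.

Definition crossing_rule (f : diagram_arc D -> Q) (k : crossing D) : Prop :=
  (if is_positive k then @qop Q else @qinv Q) (f (over_arc k)) (f (under_in k)) =
  f (under_out k).

Lemma morphism_inv (F : fund_quandle D -> Q) t u : quandle_morphism F ->
  F (\pi_(fund_quandle D) (QInv t u))%qT =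
  qinv (F (\pi_(fund_quandle D) t)%qT) (F (\pi_(fund_quandle D) u)%qT).
Proof.
move=> FM; apply: (@qop_inj _ (F (\pi_(fund_quandle D) t)%qT)).
rewrite qinvK -FM; congr F; rewrite [LHS]fund_actE.
by apply/fund_quandle_eqP/qterm_invK.
Qed.

Lemma coloring_crossing F k : coloring D Q F -> crossing_rule (F \o gen) k.
Proof.
move=> FM; have /fund_quandle_eqP := qterm_crossing k.
rewrite /crossing_rule /= /gen => <-; case: is_positive.
  by rewrite -FM; congr F; rewrite [LHS]fund_actE.
by rewrite morphism_inv.
Qed.

(** Universal property of the fundamental quandle: evaluating terms respects every rule of
    [qterm_eq], the crossing relations by hypothesis, and therefore descends to classes. *)
Lemma coloring_exists (f : diagram_arc D -> Q) : (forall k, crossing_rule f k) ->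
  exists2 F, coloring D Q F & forall a, F (gen a) = f a.
Proof.
move=> f_crossing; pose fix eval (t : qterm (diagram_arc D)) : Q :=
  match t with
  | QGen a => f a
  | QAct t u => qop (eval t) (eval u)
  | QInv t u => qinv (eval t) (eval u)
  end.
have eval_eq t u : qterm_eq t u -> eval t = eval u.
  elim=> {t u} //=.
  - by move=> t u v _ -> _ ->.
  - by move=> t t' u u' _ -> _ ->.
  - by move=> t t' u u' _ -> _ ->.
  - by move=> t; rewrite qopxx.
  - by move=> t u; rewrite qopK.
  - by move=> t u; rewrite qinvK.
  - by move=> t u v; rewrite qopD.
  - by move=> k; rewrite -f_crossing; case: is_positive.
exists (fun x => eval (generic_quotient.repr x)) => [x y|a].
  by rewrite -[RHS]/(eval (QAct _ _)); apply/eval_eq/repr_fund_quandle.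
exact/(eval_eq _ (QGen a))/repr_fund_quandle.
Qed.
End DiagramColoring.

(** * Colorings of a closure as fixed tuples *)

Section ClosureColoring.
Variables (Q : finQuandleType) (n : nat) (w : braid_word n).
Implicit Types (k : 'I_(size w)) (p q : closure_point w) (t : n.-tuple Q).
Local Notation D := (closure_diagram w).

Lemma pos_rightE k : pos_right k = rgt (letter k).1.
Proof. exact: val_inj. Qed.

Lemma letter_act_over t k a : a != under_pos k ->
  tnth (letter_act (letter k) t) (strand_end k a) = tnth t a.
Proof.
rewrite tnth_letter_act /strand_end /under_pos pos_rightE -/(lft (letter k).1).
by case: tpermP => [->|->|/eqP/negPf al /eqP/negPf ar]; case: (letter k).2;
  rewrite ?eqxx ?lft_rgt ?rgt_lft ?al ?ar.
Qed.

Lemma letter_act_under t k :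
  tnth (letter_act (letter k) t) (strand_end k (under_pos k)) =
  (if (letter k).2 then @qop Q else @qinv Q) (tnth t (over_pos k)) (tnth t (under_pos k)).
Proof.
rewrite tnth_letter_act /strand_end /under_pos /over_pos pos_rightE.
rewrite -[pos_left k]/(lft (letter k).1).
by case: (letter k).2; rewrite ?tpermL ?tpermR ?eqxx ?rgt_lft.
Qed.

Lemma strand_endK k : involutive (strand_end k).
Proof. exact: tpermK. Qed.

Lemma same_arc_sym : connect_sym
  (fun p q => closure_step p q || closure_step q p).
Proof. by apply: sym_connect_sym => p q; rewrite orbC. Qed.

Lemma arc_of_eqP p q : reflect (arc_of p = arc_of q) (same_arc p q).
Proof.
apply: (iffP idP) => [pq|/(congr1 val)/= /setP/(_ q)]; last first.
  by rewrite !inE => ->; rewrite /same_arc connect0.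
apply/val_inj/setP => r /=; rewrite !inE; exact: (same_connect same_arc_sym).
Qed.

Lemma arc_of_step p q : closure_step p q -> arc_of p = arc_of q.
Proof. by move=> pq; apply/arc_of_eqP/connect1; rewrite pq. Qed.

Lemma arc_ofP (A : closure_arc w) : exists p, A == arc_of p.
Proof. by case: A => A AP; have /existsP[p /eqP Ap] := AP; exists p; apply/eqP/val_inj. Qed.

Lemma word_perm_rcons u (l : braid_letter n) t :
  word_perm Q (rcons u l) t = letter_act l (word_perm Q u t).
Proof. by rewrite -cats1 word_perm_cat permM word_perm_cons word_perm0. Qed.

Lemma word_perm_take k t :
  word_perm Q (take k.+1 w) t = letter_act (letter k) (word_perm Q (take k w) t).
Proof.
rewrite (take_nth (letter k)) // word_perm_rcons.
by congr letter_act; exact/esym/(tnth_nth (letter k) (in_tuple w) k).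
Qed.

Definition level (F : fund_quandle D -> Q) (k : 'I_(size w).+1) : n.-tuple Q :=
  [tuple F (gen (arc_of (k, a) : diagram_arc D)) | a < n].

(** The under-strand obeys the crossing relation, and every other strand stays on the same arc. *)
Lemma level_below F k : coloring D Q F ->
  level F (lev_below k) = letter_act (letter k) (level F (lev_above k)).
Proof.
move=> FM; apply: eq_from_tnth => a; rewrite -[a](strand_endK k).
set b := strand_end k a; rewrite tnth_mktuple.
have [->|bu] := eqVneq b (under_pos k).
  by rewrite letter_act_under !tnth_mktuple -[LHS](coloring_crossing (k : crossing D) FM).
rewrite letter_act_over // tnth_mktuple; congr (F (gen _)).
apply/esym/arc_of_step/orP; left; apply/existsP; exists k; apply/existsP; exists b.
by rewrite bu !eqxx.
Qed.

Lemma level_take F (k : 'I_(size w).+1) : coloring D Q F ->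
  level F k = word_perm Q (take k w) (level F ord0).
Proof.
case: k => k; elim: k => [|k IHk] kw FM.
  by rewrite take0 word_perm0; congr level; exact: val_inj.
have -> : Ordinal kw = lev_below (Ordinal (kw : k < size w)) by exact: val_inj.
rewrite level_below // (word_perm_take (Ordinal (kw : k < size w))).
congr letter_act; rewrite -(IHk (ltnW kw)) //; congr level; exact: val_inj.
Qed.

Lemma level_max F : level F ord_max = level F ord0.
Proof.
apply: eq_from_tnth => a; rewrite !tnth_mktuple; congr (F (gen _)).
by apply/arc_of_step/orP; right; apply/existsP; exists a; rewrite !eqxx.
Qed.

(** The closing strands identify the bottom level with the top one. *)
Lemma level_fixed F : coloring D Q F ->
  word_perm Q w (level F ord0) = level F ord0.
Proof. by move=> FM; rewrite -{2}level_max (level_take ord_max) //= take_size. Qed.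

(** Every arc meets some level, and the top level determines all the others. *)
Lemma level_inj F F' : coloring D Q F -> coloring D Q F' ->
  level F ord0 = level F' ord0 -> F = F'.
Proof.
move=> FM F'M FF'; apply: coloring_ext => // A.
have [[k a] /eqP ->] := arc_ofP A.
have := congr1 (fun t => tnth t a) (level_take k FM).
by rewrite FF' -level_take // !tnth_mktuple.
Qed.

(** Pushing [t] down through [w] colors all points. The result is constant along arcs, where the
    closing strands use that [w] fixes [t], and it obeys the crossing relations by construction. *)
Lemma level_surj t : word_perm Q w t = t ->
  exists2 F, coloring D Q F & level F ord0 = t.
Proof.
move=> wt; pose col p := tnth (word_perm Q (take p.1 w) t) p.2.
have col_below k a :
    col (lev_below k, a) = tnth (letter_act (letter k) (word_perm Q (take k w) t)) a.
  by rewrite /col /= word_perm_take.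
have col_step p q : closure_step p q -> col p = col q.
  move=> /orP[/existsP[k /existsP[a /and3P[au /eqP-> /eqP->]]]|].
    by rewrite col_below letter_act_over.
  move=> /existsP[a /andP[/eqP-> /eqP->]].
  by rewrite /col /= take_size take0 word_perm0 wt.
have col_arc p q : arc_of p = arc_of q -> col p = col q.
  move=> /arc_of_eqP/connectP[s]; elim: s p => [|r s IHs] p /=; first by move=> _ ->.
  by move=> /andP[/orP[] /col_step pr rs] /(IHs _ rs) <-.
(* By [col_arc] the color does not depend on the point chosen on the arc. *)
pose f (A : diagram_arc D) : Q := col (xchoose (arc_ofP A)).
have fE p : f (arc_of p) = col p.
  by apply/col_arc/esym/eqP; exact: (xchooseP (arc_ofP (arc_of p))).
have [k|F FM FE] := @coloring_exists D Q f; last first.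
  exists F => //; apply: eq_from_tnth => a.
  by rewrite tnth_mktuple FE fE /col /= take0 word_perm0.
by rewrite /crossing_rule /= !fE col_below letter_act_under.
Qed.

(** Reading off the top level is a bijection from colorings to fixed tuples, by [level_inj],
    [level_surj] and [level_fixed]. *)
Lemma num_coloring_closure :
  num_coloring D Q = #|[set t | word_perm Q w t == t]%SET|.
Proof.
set X := [set t | _]%SET.
have XE : [set` X]%classic = ((fun F => level F ord0) @` coloring D Q)%classic.
  apply/seteqP; split=> [t /=|_ [F FM <-] /=]; rewrite inE.
    by move=> /eqP/level_surj[F FM <-]; exists F.
  by rewrite level_fixed.
have fX : finite_set [set` X]%classic by exact: finite_finset.
transitivity #|` fset_set [set` X]%classic|%fset.
  apply/fcard_eq => //; first exact: finite_coloring.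
  rewrite XE card_eq_sym; apply: inj_card_eq => F F'; rewrite !inE => FM F'M.
  exact: level_inj.
rewrite (_ : fset_set _ = [fset t in enum X]%fset); last first.
  by apply/fsetP => t; rewrite in_fset_set // !inE mem_enum; apply/idP/idP; rewrite inE.
rewrite card_fseq undup_id ?enum_uniq // -cardE //.
Qed.
End ClosureColoring.

Lemma closure_coloringsE Q n (s : braid n) :
  closure_colorings Q s = #|[set t | braid_perm Q s t == t]%SET|.
Proof. exact: num_coloring_closure. Qed.

Theorem theorem1p1 (Q : finQuandleType) :
  exists P : {poly rat}, integer_valued P /\
    exists N : nat, forall n : nat, (N <= n)%N ->
      forall (R : realType) (mu : probability (borel_profinite (braid n)) R)
             (c : profinite_completion (braid n) -> nat),
        normalized_haar mu ->
        continuous_extension (@closure_colorings Q n) c ->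
        (\int[mu]_x ((c x)%:R)%:E = (ratr (P.[n%:R])%R)%:E)%E.
Proof.
have [P P_int [N NP]] := ev_polyP (ev_poly_classes Q).
exists P; split=> //; exists N => n Nn R mu c mu_haar c_ext.
pose num_fix (h : {perm n.-tuple Q}) := #|[set t | h t == t]%SET|.
have closureE : @closure_colorings Q n = num_fix \o (@braid_perm Q n).
  by apply/funext => s; exact: closure_coloringsE.
rewrite closureE in c_ext.
(* The integrand now factors through the finite image, so the integral is the average number of
   fixed tuples. *)
rewrite (continuous_extensionE (@braid_permM Q n) c_ext) /=.
rewrite (integral_hom_ext (@braid_permM Q n) mu_haar) -(NP n Nn) ratr_int.
congr (_%:E); rewrite [X in (X%:R / _)%R](sum_card_fix_braid Q n) natrM mulfK //.
rewrite pnatr_eq0 -lt0n; apply/card_gt0P; exists (braid_perm Q 1%g).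
by apply/mem_hom_img; exists 1%g.
Qed.
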